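(* If $\mathbf{NP}\not\subseteq\mathbf{P_{/poly}}$, then $\texttt{TSP}\notin\mathbf{CF}$.
   Context: Binary strings of length $m$ are identified with vectors in $\{0,1\}^m$. $\mathbf{CF}$ is the set of languages $L\subseteq\{0,1\}^*$ for which there exists a polynomial $p$ such that for every $m\in\mathbb{N}$ there exist $A\in\mathbb{R}^{p(m)\times m}$, $B\in\mathbb{R}^{p(m)\times p(m)}$, $b\in\mathbb{R}^{p(m)}$ with $\operatorname{conv}(\{x\in L: |x|=m\})=\{x\in\mathbb{R}^m\mid\exists y\in\mathbb{R}^{p(m)}: Ax+By\le b\}$. With $K_n=([n],E_n)$ the complete undirected graph on $n$ nodes, $\texttt{TSP}=\bigcup_{n\in\mathbb{N}}\{\chi(C)\in\{0,1\}^{\binom n2}\mid C\subseteq E_n \text{ is a Hamiltonian cycle in } K_n\}$, where $\chi(C)$ is the characteristic vector of $C$. $\mathbf{P_{/poly}}$ is the class of languages decidable by families of polynomial-size Boolean circuits. *)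

(* Defs.v *)
From Stdlib Require Import Reals.
From HB Require Import structures.
From mathcomp Require Import all_boot all_order all_algebra.
From mathcomp Require Import Rstruct.
Set Implicit Arguments. Unset Strict Implicit. Unset Printing Implicit Defensive.
Import Order.TTheory GRing.Theory Num.Theory.

Definition language := seq bool -> Prop.

Definition poly_fun (p : nat -> nat) : Prop :=
  exists q : {poly int}, forall m : nat, Posz (p m) = (q.[Posz m])%R.

(* Straight-line circuits; a gate may only refer to strictly earlier gates
   (a reference to a non-existing gate / input reads as false). The output
   is the value of the last gate; the size is the number of gates. *)
Inductive gate :=
| GIn of nat | GConst of bool | GNot of nat | GAnd of nat & nat | GOr of nat & nat.

Definition gate_val (x : seq bool) (vs : seq bool) (g : gate) : bool :=
  match g with
  | GIn k => nth false x k
  | GConst b => b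
  | GNot i => ~~ nth false vs i
  | GAnd i j => nth false vs i && nth false vs j
  | GOr i j => nth false vs i || nth false vs j
  end.

Definition circuit_vals (C : seq gate) (x : seq bool) : seq bool :=
  foldl (fun vs g => rcons vs (gate_val x vs g)) [::] C.

Definition circuit_eval (C : seq gate) (x : seq bool) : bool :=
  last false (circuit_vals C x).

Definition Ppoly (L : language) : Prop :=
  exists p, poly_fun p /\ forall m : nat, exists C : seq gate,
    size C <= p m /\ forall x : seq bool, size x = m -> (L x <-> circuit_eval C x).

(* Deterministic single-tape TM, one-way infinite tape.  States 'I_Q.+1 with
   start state 0; tape alphabet 'I_G.+4 with 0 = blank, 1 = bit 0, 2 = bit 1,
   3 = separator #.  delta = None means halt. *)
Inductive move := MoveL | MoveR | MoveS.

Record TM := {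
  tm_Q : nat;
  tm_G : nat;
  tm_delta : 'I_tm_Q.+1 -> 'I_tm_G.+4 -> option ('I_tm_Q.+1 * 'I_tm_G.+4 * move);
  tm_acc : 'I_tm_Q.+1 -> bool }.

Definition config (M : TM) := ('I_(tm_Q M).+1 * (nat -> 'I_(tm_G M).+4) * nat)%type.

Definition tm_init (M : TM) (s : seq nat) : config M :=
  (ord0, fun i => inord (nth 0 s i), 0).

Definition tm_step (M : TM) (c : config M) : config M :=
  let: (q, tape, h) := c in
  match tm_delta q (tape h) with
  | None => c
  | Some (q', a, d) =>
      (q', (fun i => if i == h then a else tape i),
       match d with MoveL => h.-1 | MoveR => h.+1 | MoveS => h end)
  end.

Definition tm_halted (M : TM) (c : config M) : bool :=
  let: (q, tape, h) := c in if tm_delta q (tape h) is None then true else false.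

Definition tm_accepting (M : TM) (c : config M) : bool :=
  let: (q, _, _) := c in tm_halted c && tm_acc q.

Definition accepts_within (M : TM) (s : seq nat) (t : nat) : Prop :=
  exists k, k <= t /\ tm_accepting (iter k (@tm_step M) (tm_init M s)).

Definition enc_bits (x : seq bool) : seq nat := [seq (if b then 2 else 1) | b <- x].

Definition NP (L : language) : Prop :=
  exists (M : TM) (p q : nat -> nat), poly_fun p /\ poly_fun q /\
    forall x : seq bool,
      L x <-> exists w : seq bool, size w <= q (size x) /\
                accepts_within M (enc_bits x ++ 3 :: enc_bits w) (p (size x)).

Local Open Scope ring_scope.

Definition conv (m : nat) (S : 'cV[R]_m -> Prop) (v : 'cV[R]_m) : Prop :=
  exists (k : nat) (pts : 'I_k -> 'cV[R]_m) (lam : 'I_k -> R),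
    (forall i, S (pts i)) /\ (forall i, 0 <= lam i) /\
    \sum_(i < k) lam i = 1 /\ v = \sum_(i < k) lam i *: pts i.

Definition bitvec (m : nat) (x : seq bool) : 'cV[R]_m :=
  \col_(i < m) ((nth false x i : nat)%:R).

Definition slice (L : language) (m : nat) (v : 'cV[R]_m) : Prop :=
  exists x : seq bool, L x /\ size x = m /\ v = bitvec m x.

Definition CF (L : language) : Prop :=
  exists p : nat -> nat, poly_fun p /\ forall m : nat,
    exists (A : 'M[R]_(p m, m)) (B : 'M[R]_(p m, p m)) (b : 'cV[R]_(p m)),
      forall x : 'cV[R]_m,
        @conv m (@slice L m) x <->
        exists y : 'cV[R]_(p m), forall i : 'I_(p m), (A *m x + B *m y) i ord0 <= b i ord0.

Local Close Scope ring_scope.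

(* Edges {i,j}, i<j, of K_n on nodes 0..n-1, in lexicographic order: these index
   the binom(n,2) coordinates. *)
Definition edges (n : nat) : seq (nat * nat) :=
  [seq (i, j) | i <- iota 0 n, j <- iota i.+1 (n - i.+1)].

Definition cycle_edge (n : nat) (s : seq nat) (i j : nat) : bool :=
  has (fun k => let a := nth 0 s k in let b := nth 0 s (k.+1 %% n) in
                ((a == i) && (b == j)) || ((a == j) && (b == i))) (iota 0 n).

(* Hamiltonian cycles of K_n (n >= 3), given by a cyclic ordering s of the nodes. *)
Definition TSP : language := fun x =>
  exists (n : nat) (s : seq nat), 3 <= n /\ perm_eq s (iota 0 n) /\
    x = [seq cycle_edge n s e.1 e.2 | e <- edges n].

Definition NP_subset_Ppoly : Prop := forall L : language, NP L -> Ppoly L.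

(* Main.v *)
(* From a linear extended formulation of the TSP polytope one gets small circuits
   for Hamiltonicity as follows.  For a non-Hamiltonian graph G and a tour T the
   number |T \ G| - 1/2 is nonnegative, and Farkas' lemma turns the formulation
   into a nonnegative factorization <U_G, V_T> = |T \ G| - 1/2 of polynomial rank,
   which can be rescaled to have V_T <= 1 and U_G polynomially bounded.  Pick tours
   T_1, ..., T_k forming a barycentric spanner of the vectors (V_T, 1, chi_T), so
   that every other one is a combination of them with coefficients in [-1, 1].
   Then a graph G is non-Hamiltonian iff the k equations
   <u, V_{T_j}> = |T_j \ G| - 1/2 have a solution u in a box, and if it is
   Hamiltonian, every u violates one of them by 1/poly.  Because of this gap the
   V_T may be rounded to polynomially bounded integers and a perceptron-style
   iteration decides between the two cases in polynomially many steps; the rounded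
   data are the advice of the circuit.  Since Hamiltonicity is NP-hard under
   projections (tableau of a Turing machine, CNF formula, directed Hamiltonian
   cycle, undirected Hamiltonian cycle), NP is contained in P/poly. *)
From Stdlib Require Import Reals.
From HB Require Import structures.
From mathcomp Require Import all_boot all_order all_algebra.
From mathcomp Require Import boolp Rstruct zify ring lra.
Require Import Defs.
Set Implicit Arguments. Unset Strict Implicit. Unset Printing Implicit Defensive.
Import Order.TTheory GRing.Theory Num.Theory.

(** * Polynomially bounded functions *)

(** The entries of a formulation are arbitrary reals; only the number of inequalities is bounded.
    The rescaled factors and the spanner are what makes rounding safe. The shift by 1/2 serves
    twice. It makes |T \ G| >= 1, valid for non-Hamiltonian G, a strict inequality, as the use of
    Farkas' lemma requires. And for a tour T inside G it gives <u, V_T> - (|T \ G| - 1/2) >= 1/2 for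
    every u >= 0. The coordinates 1 and chi_T of the spanner allow this residual to be written as a
    combination of the residuals of T_1, ..., T_k, so one of these is at least 1/(2k) in absolute
    value. The perceptron sums residuals at box vertices: with an exact solution the squared norm of
    the sum grows linearly in the number of steps, whereas with a gap some coordinate itself does,
    so a threshold separates the cases. All numbers stay polynomially bounded integers, so each can
    be stored by one gate per value and arithmetic is done by tables. Under a projection each edge
    depends on one input bit, so the reduction needs no circuit of its own. *)

Definition poly_bounded (f : nat -> nat) : Prop :=
  exists c d, forall m, f m <= c * m.+1 ^ d.

Lemma poly_bounded_le (f g : nat -> nat) :
  (forall m, f m <= g m) -> poly_bounded g -> poly_bounded f.
Proof. by move=> fg [c [d h]]; exists c, d => m; apply: leq_trans (fg m) (h m). Qed.

Lemma poly_bounded_const k : poly_bounded (fun=> k).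
Proof. by exists k, 0 => m; rewrite muln1. Qed.

Lemma poly_bounded_id : poly_bounded id.
Proof. by exists 1, 1 => m; rewrite mul1n expn1. Qed.

Lemma poly_bounded_add (f g : nat -> nat) :
  poly_bounded f -> poly_bounded g -> poly_bounded (fun m => f m + g m).
Proof.
move=> [c [d hf]] [c' [d' hg]]; exists (c + c'), (d + d') => m.
rewrite mulnDl leq_add //.
  apply: leq_trans (hf m) _; rewrite leq_mul2l leq_pexp2l ?leq_addr ?orbT //.
apply: leq_trans (hg m) _; rewrite leq_mul2l leq_pexp2l ?leq_addl ?orbT //.
Qed.

Lemma poly_bounded_mul (f g : nat -> nat) :
  poly_bounded f -> poly_bounded g -> poly_bounded (fun m => f m * g m).
Proof.
move=> [c [d hf]] [c' [d' hg]]; exists (c * c'), (d + d') => m.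
by rewrite expnD mulnACA leq_mul.
Qed.

Lemma poly_bounded_exp (f : nat -> nat) k :
  poly_bounded f -> poly_bounded (fun m => f m ^ k).
Proof.
move=> hf; elim: k => [|k IH]; first exact: poly_bounded_const 1.
apply: (poly_bounded_le (g := fun m => f m * f m ^ k)); last exact: poly_bounded_mul.
by move=> m; rewrite expnS.
Qed.

Lemma poly_bounded_comp (f g : nat -> nat) :
  poly_bounded f -> poly_bounded g -> poly_bounded (fun m => f (g m)).
Proof.
move=> [c [d hf]] hg.
apply: (poly_bounded_le (g := fun m => c * (g m + 1) ^ d)).
  by move=> m; rewrite addn1; apply: hf.
apply: poly_bounded_mul; first exact: poly_bounded_const.
apply: poly_bounded_exp; apply: poly_bounded_add hg _; exact: poly_bounded_const.
Qed.

Lemma PoszX (m k : nat) : Posz (m ^ k) = (Posz m ^+ k)%R.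
Proof. by elim: k => // k IH; rewrite expnS exprS PoszM IH. Qed.

Lemma poly_fun_bounded p : poly_fun p -> poly_bounded p.
Proof.
move=> [q hq].
have: poly_bounded (fun m => \sum_(i < size q) `|(q`_i)%R|%N * m ^ i).
  elim: (size q) => [|k IH].
    by apply: (poly_bounded_le (g := fun=> 0)) (poly_bounded_const 0) => m; rewrite big_ord0.
  apply: (poly_bounded_le (g := fun m => \sum_(i < k) `|(q`_i)%R|%N * m ^ i
                                         + `|(q`_k)%R|%N * m ^ k)).
    by move=> m; rewrite big_ord_recr.
  apply: poly_bounded_add => //; apply: poly_bounded_mul; first exact: poly_bounded_const.
  exact: poly_bounded_exp poly_bounded_id.
apply: poly_bounded_le => m.
rewrite -lez_nat hq horner_coef (big_morph Posz PoszD (erefl (Posz 0))).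
apply: ler_sum => i _.
by rewrite PoszM PoszX abszE ler_wpM2r ?ler_norm // exprn_ge0.
Qed.

Lemma poly_bounded_fun f :
  poly_bounded f -> exists2 p, poly_fun p & forall m, f m <= p m.
Proof.
move=> [c [d h]]; exists (fun m => c * m.+1 ^ d) => //.
exists ((Posz c)%:P * ('X + 1%:P) ^+ d)%R => m.
rewrite !hornerE PoszM PoszX; congr (_ * _ ^+ _)%R.
by rewrite -addn1 PoszD.
Qed.

(** * Circuits over finite domains *)

Lemma circuit_vals_rcons C g x :
  circuit_vals (rcons C g) x = rcons (circuit_vals C x) (gate_val x (circuit_vals C x) g).
Proof. by rewrite /circuit_vals foldl_rcons. Qed.

Lemma size_circuit_vals C x : size (circuit_vals C x) = size C.
Proof. by elim/last_ind: C => // C g IH; rewrite circuit_vals_rcons !size_rcons IH. Qed.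

Definition has_gate m (C : seq gate) (f : seq bool -> bool) : Prop :=
  exists2 i, i < size C & forall x, size x = m -> nth false (circuit_vals C x) i = f x.

Lemma has_gate_rcons m C g f : has_gate m C f -> has_gate m (rcons C g) f.
Proof.
move=> [i lti hi]; exists i; first by rewrite size_rcons ltnW.
by move=> x hx; rewrite circuit_vals_rcons nth_rcons size_circuit_vals lti hi.
Qed.

Lemma has_gate_cat m C C' f : has_gate m C f -> has_gate m (C ++ C') f.
Proof.
elim/last_ind: C' => [|C' g IH] h; first by rewrite cats0.
by rewrite -rcons_cat; apply/has_gate_rcons/IH.
Qed.

Lemma has_gate_last m C g (f : seq bool -> bool) :
  (forall x, size x = m -> gate_val x (circuit_vals C x) g = f x) ->
  has_gate m (rcons C g) f.
Proof.
move=> h; exists (size C); first by rewrite size_rcons.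
move=> x hx; rewrite circuit_vals_rcons nth_rcons size_circuit_vals ltnn eqxx; exact: h.
Qed.

Lemma has_gate_or_and (I : Type) m C (l : seq I) (f g : I -> seq bool -> bool) :
  (forall i, List.In i l -> has_gate m C (f i) /\ has_gate m C (g i)) ->
  exists2 C', size C' <= (2 * size l).+1 &
    has_gate m (C ++ C') (fun x => has (fun i => f i x && g i x) l).
Proof.
elim: l => [|i l IH] h.
  exists [:: GConst false] => //; rewrite cats1; exact: has_gate_last.
have [|C' sC' [a ha va]] := IH; first by move=> j hj; apply: h; right.
have [hf hg] := h i (or_introl (erefl i)).
have [b hb vb] := has_gate_cat C' hf; have [c hc vc] := has_gate_cat C' hg.
exists (rcons (rcons C' (GAnd b c)) (GOr (size (C ++ C')) a)).
  by rewrite !size_rcons /= mulnS !addSn add0n !ltnS.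
rewrite -!rcons_cat; apply: has_gate_last => x hx.
rewrite /= circuit_vals_rcons !nth_rcons !size_circuit_vals ltnn eqxx /= ha.
by rewrite va // vb // vc.
Qed.

(* A function with values in the list [dom] is stored as one gate per value. *)
Definition onehot m (X : eqType) (dom : seq X) (C : seq gate) (f : seq bool -> X) : Prop :=
  (forall x, size x = m -> f x \in dom) /\
  (forall v, v \in dom -> has_gate m C (fun x => f x == v)).

(** [T] is the set of functions available so far: one circuit carries all of them at once, so later
    gates can share them. *)
Definition computes m (X : eqType) (dom : seq X) (k : nat)
    (T : (seq bool -> X) -> Prop) : Prop :=
  exists2 C, size C <= k & forall f, T f -> onehot m dom C f.

Definition addf (X : Type) (T : (seq bool -> X) -> Prop) h f := T f \/ f = h.

Definition addfs (X : Type) (T : (seq bool -> X) -> Prop) N (F : nat -> seq bool -> X) f :=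
  T f \/ exists2 j, j < N & f = F j.

(** Quantifying over all larger [T'] makes the cost independent of what else has been added, so
    additions can be chained. *)
Definition addable m (X : eqType) (dom : seq X) (T : (seq bool -> X) -> Prop) c h : Prop :=
  forall k T', (forall f, T f -> T' f) ->
    computes m dom k T' -> computes m dom (k + c) (addf T' h).

(** For each of [d] output values, a disjunction over at most [d * d] pairs of arguments: two gates
    per pair and one for the empty disjunction. *)
Definition op_cost (d : nat) := d * (2 * (d * d)).+1.

Section Computes.
Variables (m : nat) (X : eqType) (dom : seq X).
Implicit Types (T : (seq bool -> X) -> Prop) (f g h : seq bool -> X).

Lemma computes_sub k k' T T' :
  k <= k' -> (forall f, T' f -> T f) -> computes m dom k T -> computes m dom k' T'.
Proof.
move=> kk' sT [C sC hC]; exists C; first exact: leq_trans sC kk'.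
by move=> f /sT /hC.
Qed.

Lemma onehot_cat C C' f : onehot m dom C f -> onehot m dom (C ++ C') f.
Proof. by move=> [h1 h2]; split=> // v /h2; apply: has_gate_cat. Qed.

Lemma has_gates_all C (c : nat) (P : X -> seq bool -> bool) (vs : seq X) :
  (forall C0 v, v \in vs ->
    exists2 C', size C' <= c & has_gate m ((C ++ C0) ++ C') (P v)) ->
  exists2 C', size C' <= size vs * c & forall v, v \in vs -> has_gate m (C ++ C') (P v).
Proof.
elim: vs => [|v vs IH] h; first by exists [::].
have [|C' sC' hC'] := IH; first by move=> C0 w hw; apply: h; rewrite inE hw orbT.
have [|C2 sC2 hC2] := h C' v; first by rewrite inE eqxx.
exists (C' ++ C2); first by rewrite size_cat mulSn addnC leq_add.
move=> w; rewrite inE catA => /orP[/eqP->//|/hC' hw]; exact: has_gate_cat.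
Qed.

(** The operation is tabulated: the gate for [v] collects the argument pairs that [op] sends to [v].
    Membership in [dom] is asked only of values taken on actual inputs, which is how range bounds
    enter. *)
Lemma addable_op T f g h (op : X -> X -> X) :
  T f -> T g -> (forall x, size x = m -> h x = op (f x) (g x)) ->
  (forall x, size x = m -> h x \in dom) -> addable m dom T (op_cost (size dom)) h.
Proof.
move=> Tf Tg hop hdom k T' sT [C sC hC].
have [hf1 hf2] := hC f (sT f Tf); have [hg1 hg2] := hC g (sT g Tg).
pose l v := [seq p <- [seq (a, b) | a <- dom, b <- dom] | op p.1 p.2 == v].
pose P v x := has (fun p => (f x == p.1) && (g x == p.2)) (l v).
have [|C' sC' hC'] := @has_gates_all C (2 * (size dom * size dom)).+1 P dom.
  move=> C0 v hv.
  have [|C' sC' hC'] := @has_gate_or_and _ m (C ++ C0) (l v)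
      (fun p x => f x == p.1) (fun p x => g x == p.2).
    move=> p hp.
    have: p \in [seq (a, b) | a <- dom, b <- dom].
      have : p \in l v.
        elim: (l v) hp => //= q s IH [->|/IH hp]; rewrite inE ?eqxx //.
        by rewrite hp orbT.
      by rewrite mem_filter => /andP[].
    move=> /allpairsP[[a b] [/= ha hb ->]].
    by split; apply: has_gate_cat => /=; [apply: hf2|apply: hg2].
  exists C' => //; apply: leq_trans sC' _.
  by rewrite ltnS leq_mul2l -(size_allpairs pair) size_filter count_size orbT.
exists (C ++ C'); first by rewrite size_cat leq_add.
move=> f' [/hC|->]; first exact: onehot_cat.
split=> // v hv; have [i hi vi] := hC' v hv; exists i => // x hx.
rewrite vi // hop //; apply/hasP/eqP => [[p] | <-].
  by rewrite mem_filter => /andP[/eqP <- _] /andP[/eqP-> /eqP->].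
exists (f x, g x); last by rewrite !eqxx.
by rewrite mem_filter eqxx /=; apply: allpairs_f; [apply: hf1|apply: hg1].
Qed.

(** For a fixed value the test is constant, the input bit or its negation, hence at most two gates.
    A constant [phi] supplies constants. *)
Lemma addable_input T h i (phi : bool -> X) :
  (forall x, size x = m -> h x = phi (nth false x i)) ->
  (forall b, phi b \in dom) -> addable m dom T (op_cost (size dom)) h.
Proof.
move=> hphi hdom k T' sT [C sC hC].
have [|C' sC' hC'] := @has_gates_all C 2 (fun v x => h x == v) dom.
  move=> C0 v hv.
  have [e1|n1] := eqVneq (phi true) v; have [e2|n2] := eqVneq (phi false) v.
  - exists [:: GConst true] => //; rewrite cats1; apply: has_gate_last => x hx.
    by rewrite /= hphi //; case: nth; rewrite ?e1 ?e2 eqxx.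
  - exists [:: GIn i] => //; rewrite cats1; apply: has_gate_last => x hx.
    by rewrite /= hphi //; case: nth; rewrite ?e1 ?eqxx // (negPf n2).
  - exists [:: GIn i; GNot (size (C ++ C0))] => //.
    rewrite -cat_rcons cats1; apply: has_gate_last => x hx.
    rewrite /= circuit_vals_rcons nth_rcons size_circuit_vals ltnn eqxx /= hphi //.
    by case: nth; rewrite ?e2 ?eqxx // (negPf n1).
  - exists [:: GConst false] => //; rewrite cats1; apply: has_gate_last => x hx.
    by rewrite /= hphi //; case: nth; rewrite ?(negPf n1) ?(negPf n2).
exists (C ++ C').
  rewrite size_cat leq_add // (leq_trans sC') // /op_cost leq_mul2l.
  by case: (size dom) => // d; rewrite mulnS !addSn add0n.
move=> f' [/hC|->]; first exact: onehot_cat.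
by split=> // x hx; rewrite hphi.
Qed.

Lemma addable_trans T g h c c' :
  addable m dom T c g -> addable m dom (addf T g) c' h -> addable m dom T (c + c') h.
Proof.
move=> hg hh k T' sT hT'.
have := hh _ (addf T' g) _ (hg k T' sT hT'); rewrite addnA => H.
apply: computes_sub (leqnn _) _ (H _).
  by move=> f [Tf|->]; [left; left|right].
by move=> f [/sT Tf|->]; [left|right].
Qed.

Lemma computes_family T k c N (F : nat -> seq bool -> X) :
  (forall j, j < N -> addable m dom T c (F j)) -> computes m dom k T ->
  computes m dom (k + N * c) (addfs T N F).
Proof.
elim: N => [|N IH] hF hT.
  by rewrite addn0; apply: computes_sub hT => // f [//|[]].
have {}IH := IH (fun j hj => hF j (ltnW hj)) hT.
have := hF N (ltnSn N) _ _ _ IH; rewrite -addnA [N * c + c]addnC -mulSn => H.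
apply: computes_sub (leqnn _) _ (H _); last by left.
move=> f [Tf|[j]]; first by left; left.
rewrite ltnS leq_eqVlt => /orP[/eqP->|hj] ->; first by right.
by left; right; exists j.
Qed.

Lemma computes_exists T k N (F : nat -> seq bool -> X) (P : pred X) :
  (forall j, j < N -> T (F j)) -> computes m dom k T ->
  exists2 C, size C <= k + (2 * (N * size dom)).+2 &
    forall x, size x = m -> circuit_eval C x = has (fun j => P (F j x)) (iota 0 N).
Proof.
move=> TF [C sC hC].
pose l := [seq p <- [seq (j, v) | j <- iota 0 N, v <- dom] | P p.2].
have [|C' sC' [i hi vi]] := @has_gate_or_and _ m C l
   (fun p x => F p.1 x == p.2) (fun p x => F p.1 x == p.2).
  move=> p hp.
  have: p \in [seq (j, v) | j <- iota 0 N, v <- dom].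
    have : p \in l.
      elim: l hp => //= q s IH [->|/IH hp]; rewrite inE ?eqxx //.
      by rewrite hp orbT.
    by rewrite mem_filter => /andP[].
  move=> /allpairsP[[j v] [/=]]; rewrite mem_iota => /andP[_ hj] hv ->.
  by have [_ h] := hC _ (TF j hj); split; apply: h.
(* The output is read off the last gate, so the result at position [i] is copied to the end. *)
exists (rcons (C ++ C') (GOr i i)).
  rewrite size_rcons size_cat addnS ltnS leq_add // (leq_trans sC') //.
  rewrite ltnS leq_mul2l size_filter (leq_trans (count_size _ _)) ?orbT //.
  by rewrite size_allpairs size_iota.
move=> x hx; rewrite /circuit_eval circuit_vals_rcons last_rcons /= orbb vi //.
apply/hasP/hasP => [[p]|[j]].
  rewrite mem_filter => /andP[Pp /allpairsP[[j v] [/= hj hv e]]]; subst p => /=.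
  by rewrite andbb => /eqP Fj; exists j => //; rewrite Fj.
move=> hj PF; exists (j, F j x) => /=; last by rewrite eqxx.
rewrite mem_filter PF /=; apply: (allpairs_f pair) => //.
move: hj; rewrite mem_iota => /andP[_ hj]; by have [h _] := hC _ (TF j hj); apply: h.
Qed.

End Computes.

(** * The perceptron iteration *)

Section Perceptron.
Local Open Scope ring_scope.
Variables (F : realFieldType) (r N : nat) (W : nat -> nat -> F) (beta : nat -> F) (mu : F).
Hypothesis mu_ge0 : 0 <= mu.

Definition affine_val (u : nat -> F) (j : nat) : F := \sum_(l < r) W j l * u l + beta j.

Definition score (Y : nat -> F) (l : nat) : F := \sum_(j < N) W j l * Y j.

(** [score Y l] is the coefficient of [u l] in the pairing of [Y] with the residuals [affine_val u],
    so this vertex minimizes that pairing over the box. *)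
Definition best_vertex (Y : nat -> F) (l : nat) : F := if score Y l < 0 then mu else 0.

Fixpoint perceptron (s : nat) : nat -> F :=
  if s is s'.+1 then
    fun j => perceptron s' j + affine_val (best_vertex (perceptron s')) j
  else fun=> 0.

Definition in_box (u : nat -> F) := forall l, (l < r)%N -> 0 <= u l <= mu.

Lemma best_vertex_box (Y : nat -> F) : in_box (best_vertex Y).
Proof. by move=> l _; rewrite /best_vertex; case: ifP; rewrite ?lexx ?mu_ge0. Qed.

Lemma best_vertex_min (Y u : nat -> F) : in_box u ->
  \sum_(j < N) Y j * affine_val (best_vertex Y) j <= \sum_(j < N) Y j * affine_val u j.
Proof.
move=> hu.
have E v : \sum_(j < N) Y j * affine_val v j =
    \sum_(l < r) score Y l * v l + \sum_(j < N) Y j * beta j.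
  transitivity (\sum_(j < N) (\sum_(l < r) W j l * Y j * v l + Y j * beta j)).
    apply: eq_bigr => j _; rewrite mulrDr mulr_sumr; congr (_ + _).
    by apply: eq_bigr => l _; ring.
  rewrite big_split exchange_big /=; congr (_ + _).
  by apply: eq_bigr => l _; rewrite mulr_suml.
rewrite !E lerD2r; apply: ler_sum => l _.
have /andP[u0 u1] := hu l (ltn_ord l); rewrite /best_vertex; case: ltP => h.
  by rewrite ler_wnM2l // ltW.
by rewrite mulr0 mulr_ge0.
Qed.

Variable Z : F.
Hypothesis affine_bound : forall u j, (j < N)%N -> in_box u -> `|affine_val u j| <= Z.

Lemma perceptron_bound s j : (j < N)%N -> `|perceptron s j| <= s%:R * Z.
Proof.
move=> hj; elim: s => [|s IH] /=; first by rewrite normr0 mul0r.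
rewrite -natr1 mulrDl mul1r (le_trans (ler_normD _ _)) // lerD //.
by apply: affine_bound => //; apply: best_vertex_box.
Qed.

(** A step with residual a changes the squared norm by 2 <Y, a> + |a|^2. By the choice of the
    vertex, <Y, a> is at most its value at the near-solution [u], whose residuals are at most [E].
    For E = 0 the bound is linear in [s]. *)
Lemma perceptron_feasible E u s : 0 <= Z -> 0 <= E -> in_box u ->
    (forall j, (j < N)%N -> `|affine_val u j| <= E) ->
  \sum_(j < N) perceptron s j ^+ 2 <=
    s%:R * (2 * N%:R * E * (s%:R * Z) + N%:R * Z ^+ 2).
Proof.
move=> Z0 E0 hu hE; elim: s => [|s IH].
  by rewrite mul0r big1 // => j _; rewrite expr0n.
set Y := perceptron s in IH *; set a := affine_val (best_vertex Y).
have -> : \sum_(j < N) perceptron s.+1 j ^+ 2 =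
   \sum_(j < N) Y j ^+ 2 + 2 * (\sum_(j < N) Y j * a j) + \sum_(j < N) a j ^+ 2.
  rewrite mulr_sumr -!big_split /=; apply: eq_bigr => j _.
  by rewrite -/Y -/a; ring.
have h1 : \sum_(j < N) Y j * a j <= N%:R * (E * (s%:R * Z)).
  apply: le_trans (best_vertex_min Y hu) _.
  rewrite mulr_natl -[X in _ *+ X]card_ord -sumr_const; apply: ler_sum => j _.
  apply: le_trans (ler_norm _) _; rewrite normrM mulrC.
  by apply: ler_pM => //; [apply: hE|apply: perceptron_bound].
have h2 : \sum_(j < N) a j ^+ 2 <= N%:R * Z ^+ 2.
  rewrite mulr_natl -[X in _ *+ X]card_ord -sumr_const; apply: ler_sum => j _.
  rewrite -real_normK ?num_real // lerXn2r ?nnegrE //.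
  by apply: affine_bound => //; apply: best_vertex_box.
have h3 : 0 <= N%:R * E * Z by rewrite !mulr_ge0.
have s0 : 0 <= s%:R :> F by [].
rewrite -natr1; nra.
Qed.

(** The residual is affine in [u], so the state after [s] steps is [s] times the residual at the
    average of the vertices used, and this average lies in the box. *)
Lemma perceptron_infeasible L s : (0 < s)%N ->
    (forall u, in_box u -> exists2 j, (j < N)%N & L <= `|affine_val u j|) ->
  exists2 j, (j < N)%N & s%:R * L <= `|perceptron s j|.
Proof.
move=> s0 hL.
have sn0 : s%:R != 0 :> F by rewrite pnatr_eq0 -lt0n.
pose U s l := \sum_(i < s) best_vertex (perceptron i) l.
have E k j : perceptron k j = \sum_(l < r) W j l * U k l + k%:R * beta j.
  elim: k => [|k IH] /=.
    by rewrite mul0r big1 ?addr0 // => l _; rewrite /U big_ord0 mulr0.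
  rewrite IH /affine_val -natr1 mulrDl mul1r addrACA -big_split /=.
  congr (_ + _); apply: eq_bigr => l _; rewrite -mulrDr /U big_ord_recr //.
have [|j hj hLj] := hL (fun l => U s l / s%:R).
  move=> l hl; rewrite divr_ge0 ?sumr_ge0 //=; last first.
    by move=> i _; have /andP[] := best_vertex_box (perceptron i) hl.
  rewrite ler_pdivrMr ?ltr0n // mulr_natr -[X in _ *+ X]card_ord -sumr_const.
  by apply: ler_sum => i _; have /andP[] := best_vertex_box (perceptron i) hl.
exists j => //.
suff -> : perceptron s j = s%:R * affine_val (fun l => U s l / s%:R) j.
  by rewrite normrM normr_nat ler_wpM2l.
rewrite E mulrDr mulr_sumr; congr (_ + _); apply: eq_bigr => l _; field.
exact: sn0.
Qed.

End Perceptron.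

(** * Circuits that run the perceptron on bounded integers *)

Definition small_ints (D : nat) : seq R :=
  [seq (Posz k - Posz D)%:~R%R | k <- iota 0 (2 * D).+1].

Lemma mem_small_ints D (v : R) :
  v \is a Num.int -> (`|v| <= D%:R)%R -> v \in small_ints D.
Proof.
move=> /intrP[z ->]; rewrite -intr_norm -[D%:R%R]/((Posz D)%:~R%R) ler_int => hz.
apply/mapP; exists (absz (z + Posz D)%R); first by rewrite mem_iota; lia.
congr (_%:~R)%R; lia.
Qed.

Section SumCircuit.
Local Open Scope ring_scope.
Variables (m D : nat) (T : (seq bool -> R) -> Prop).
Let dom := small_ints D.
Let c0 := op_cost (size dom).

(** Terms are added one at a time; the bound on the sum of absolute values keeps every partial sum
    in the domain. The operation beyond the [k] additions copies [base]. *)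
Lemma addable_sum k (w : nat -> R) (g : nat -> seq bool -> R) base h :
  T base -> (forall a, (a < k)%N -> T (g a)) ->
  (forall a, (a < k)%N -> w a \is a Num.int) ->
  (forall a x, (a < k)%N -> size x = m -> g a x \is a Num.int) ->
  (forall x, size x = m -> base x \is a Num.int) ->
  (forall x, size x = m -> `|base x| + \sum_(a < k) `|w a * g a x| <= D%:R) ->
  (forall x, size x = m -> h x = base x + \sum_(a < k) w a * g a x) ->
  addable m dom T (k.+1 * c0)%N h.
Proof.
move=> Tb Tg wi gi bi; elim: k h Tg wi gi => [|k IH] h Tg wi gi hD hh.
  rewrite mul1n; apply: (addable_op (op := fun a _ => a) Tb Tb).
    by move=> x hx; rewrite hh // big_ord0 addr0.
  move=> x hx; rewrite hh // big_ord0 addr0.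
  by apply: mem_small_ints; [exact: bi|have := hD x hx; rewrite big_ord0 addr0].
pose h' x := base x + \sum_(a < k) w a * g a x.
rewrite mulSn addnC; apply: (addable_trans (g := h')).
  apply: IH => //.
  - by move=> a ha; apply: Tg; apply: ltnW.
  - by move=> a ha; apply: wi; apply: ltnW.
  - by move=> a x ha; apply: gi; apply: ltnW.
  move=> x hx; apply: le_trans _ (hD x hx); rewrite lerD2l big_ord_recr /=.
  by rewrite lerDl.
apply: (addable_op (f := h') (g := g k) (op := fun a b => a + w k * b)).
- by right.
- by left; apply: Tg.
- by move=> x hx; rewrite hh // /h' big_ord_recr /= addrA.
move=> x hx; apply: mem_small_ints.
  rewrite hh // rpredD ?bi // rpred_sum // => a _.
  by rewrite rpredM ?wi ?gi.
rewrite hh //; apply: le_trans (hD x hx).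
by rewrite (le_trans (ler_normD _ _)) // lerD2l ler_norm_sum.
Qed.

End SumCircuit.

Lemma sum_le_const (F : numDomainType) k (f : nat -> F) (B : F) :
  (forall a, (a < k)%N -> f a <= B)%R -> (\sum_(a < k) f a <= k%:R * B)%R.
Proof.
move=> h; rewrite mulr_natl -[X in (_ *+ X)%R]card_ord -sumr_const.
by apply: ler_sum => i _; apply: h.
Qed.

(** In order: [r] scores, [r] sign tests, [N] residuals, [N] updates of the state. *)
Definition step_cost r N c0 := r * (N.+1 * c0) + r * c0 + N * (r.+1 * c0) + N * c0.

Section PerceptronCircuit.
Local Open Scope ring_scope.
Variables (m D r N w M Z S : nat) (W : nat -> nat -> R) (beta : nat -> seq bool -> R).
Variable T : (seq bool -> R) -> Prop.
Let dom := small_ints D.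
Let c0 := op_cost (size dom).

Hypothesis T0 : T (fun=> 0).
Hypothesis Tbeta : forall j, (j < N)%N -> T (beta j).
Hypothesis W_int : forall j l, (j < N)%N -> (l < r)%N -> W j l \is a Num.int.
Hypothesis W_le : forall j l, (j < N)%N -> (l < r)%N -> `|W j l| <= w%:R.
Hypothesis beta_int : forall j x, (j < N)%N -> size x = m -> beta j x \is a Num.int.
Hypothesis beta_le : forall j x, (j < N)%N -> size x = m ->
  `|beta j x| + (r * (w * M))%:R <= Z%:R.
Hypothesis D_ge : (M + Z + S * Z + N * (w * (S * Z)) <= D)%N.

Definition pstate s j x := perceptron r N W (beta^~ x) M%:R s j.

Lemma affine_val_le (v : nat -> R) j x : (j < N)%N -> size x = m ->
  in_box r M%:R v -> `|affine_val r W (beta^~ x) v j| <= Z%:R.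
Proof.
move=> hj hx hv; apply: le_trans (beta_le hj hx); rewrite [leRHS]addrC.
rewrite (le_trans (ler_normD _ _)) // lerD2r (le_trans (ler_norm_sum _ _ _)) //.
rewrite natrM; apply: (@sum_le_const _ _ (fun l => `|W j l * v l|)) => l hl.
have /andP[v0 v1] := hv l hl.
by rewrite normrM natrM ler_pM ?W_le // ger0_norm.
Qed.

Lemma pstate_le s j x : (j < N)%N -> size x = m -> `|pstate s j x| <= (s * Z)%:R.
Proof.
move=> hj hx; rewrite natrM; apply: perceptron_bound => //.
by move=> v j' hj' hv; apply: affine_val_le.
Qed.

Lemma best_vertex_int Y l : best_vertex N W (M%:R : R) Y l \is a Num.int.
Proof. by rewrite /best_vertex; case: ifP. Qed.

Lemma affine_val_int (v : nat -> R) j x : (j < N)%N -> size x = m ->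
  (forall l, v l \is a Num.int) -> affine_val r W (beta^~ x) v j \is a Num.int.
Proof.
move=> hj hx hv; rewrite rpredD ?beta_int // rpred_sum // => l _.
by rewrite rpredM ?W_int.
Qed.

Lemma pstate_int s j x : (j < N)%N -> size x = m -> pstate s j x \is a Num.int.
Proof.
move=> hj hx; rewrite /pstate; elim: s => [|s IH] //=.
by rewrite rpredD // affine_val_int // => l; apply: best_vertex_int.
Qed.

Definition with_state s := addfs T N (pstate s).

(** The summands of [D_ge] bound, in turn, box coordinates, residuals, states and scores. Afterwards
    only [T] and the new state are kept, so the set of available functions does not grow with
    [s]. *)
Lemma computes_step s k : (s.+1 <= S)%N -> computes m dom k (with_state s) ->
  computes m dom (k + step_cost r N c0)%N (with_state s.+1).
Proof.
move=> sS hk.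
have sZ : (s * Z <= S * Z)%N by rewrite leq_mul2r ltnW ?orbT.
have sZ1 : (s.+1 * Z <= S * Z)%N by rewrite leq_mul2r sS orbT.
pose sc l x := score N W (fun j => pstate s j x) l.
pose bv l x := best_vertex N W M%:R (fun j => pstate s j x) l.
pose av j x := affine_val r W (beta^~ x) (bv^~ x) j.
have a1 l : (l < r)%N -> addable m dom (with_state s) (N.+1 * c0) (sc l).
  move=> hl.
  apply: (@addable_sum _ _ _ N (fun j => W j l) (pstate s) (fun=> 0)).
  - by left.
  - by move=> j hj; right; exists j.
  - by move=> j hj; apply: W_int.
  - by move=> j x; apply: pstate_int.
  - by [].
  - move=> x hx; rewrite normr0 add0r.
    apply: (@le_trans _ _ (N%:R * (w * (s * Z))%:R)).
      apply: (@sum_le_const _ _ (fun j => `|W j l * pstate s j x|)) => j hj.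
      by rewrite normrM natrM ler_pM ?W_le ?pstate_le.
    rewrite -natrM ler_nat; apply: leq_trans D_ge; apply: leq_trans (leq_addl _ _).
    by rewrite !leq_mul2l sZ !orbT.
  by move=> x hx; rewrite add0r.
have {hk}h1 := computes_family a1 hk.
have a2 l : (l < r)%N -> addable m dom (addfs (with_state s) r sc) c0 (bv l).
  move=> hl; apply: (addable_op (f := sc l) (g := sc l)
      (op := fun a _ => if a < 0 then M%:R else 0)).
  - by right; exists l.
  - by right; exists l.
  - by [].
  move=> x hx; apply: mem_small_ints; first exact: best_vertex_int.
  have /andP[b0 b1] := best_vertex_box (r := r) N W (ler0n _ M) (fun j => pstate s j x) hl.
  rewrite ger0_norm // (le_trans b1) // ler_nat; apply: leq_trans D_ge.
  by rewrite -!addnA leq_addr.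
have {a2}h2 := computes_family a2 h1.
have a3 j : (j < N)%N -> addable m dom (addfs (addfs (with_state s) r sc) r bv) (r.+1 * c0)%N (av j).
  move=> hj.
  apply: (@addable_sum _ _ _ r (fun l => W j l) bv (beta j)).
  - by left; left; left; apply: Tbeta.
  - by move=> l hl; right; exists l.
  - by move=> l hl; apply: W_int.
  - by move=> l x _ _; apply: best_vertex_int.
  - by move=> x; apply: beta_int.
  - move=> x hx; apply: (@le_trans _ _ Z%:R); last first.
      rewrite ler_nat; apply: leq_trans D_ge.
      lia.
    apply: le_trans (beta_le hj hx); rewrite lerD2l natrM.
    apply: (@sum_le_const _ _ (fun l => `|W j l * bv l x|)) => l hl.
    rewrite normrM natrM ler_pM ?W_le //.
    have /andP[b0 b1] := best_vertex_box (r := r) N W (ler0n _ M) (fun j => pstate s j x) hl.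
    by rewrite ger0_norm.
  by move=> x hx; rewrite /av /affine_val addrC.
have {a3}h3 := computes_family a3 h2.
have a4 j : (j < N)%N -> addable m dom (addfs (addfs (addfs (with_state s) r sc) r bv) N av) c0 ((pstate s.+1) j).
  move=> hj; apply: (addable_op (f := pstate s j) (g := av j) (op := +%R)).
  - by left; left; left; right; exists j.
  - by right; exists j.
  - by [].
  move=> x hx; apply: mem_small_ints; first exact: pstate_int.
  apply: le_trans (pstate_le s.+1 hj hx) _.
  rewrite ler_nat; apply: leq_trans D_ge; apply: leq_trans sZ1 _.
  lia.
have h4 := computes_family a4 h3.
apply: (computes_sub _ _ h4); first by rewrite /step_cost; lia.
by move=> f [Tf|hf]; [do 5!left|right].
Qed.

Lemma computes_perceptron k : computes m dom k T ->
  computes m dom (k + S * step_cost r N c0)%N (with_state S).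
Proof.
(* Only the number of steps is generalized; the bound [S] on it, to which [D_ge] refers, stays
   fixed. *)
move=> hk; have: (S <= S)%N by []; move: {1 3 4}S => s; elim: s => [|s IH] hs.
  by rewrite addn0; apply: computes_sub hk => // f [//|[j _ ->]].
have := computes_step hs (IH (ltnW hs)).
apply: computes_sub => //; rewrite mulSn; lia.
Qed.

End PerceptronCircuit.

(** * Deciding a system of equations with a gap *)

(* For vectors rounded to multiples of 1/K the perceptron moves by at most
   Z = K zeta per step; a solvable system gives a vector of error at most E, hence
   a squared state of at most S (2 n E S Z + n Z^2) after S steps, whereas a gap
   1/(2n) makes some coordinate at least S L with L = K/n - E.  The choices of K
   ([pc_scale]) and S ([pc_steps]) make the former smaller than (S L)^2. *)
Definition pc_zeta M r := 2 * M * r.+1 + 1.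
Definition pc_err M r := 2 * r * M.
Definition pc_scale M r n := 16 * n ^ 3 * pc_err M r * pc_zeta M r + 1.
Definition pc_steps M r n := 8 * n ^ 3 * pc_zeta M r ^ 2 + 1.
Definition pc_bound M r n := pc_scale M r n * pc_zeta M r.
Definition pc_range M r n := M + pc_bound M r n + pc_steps M r n * pc_bound M r n
  + n * (2 * pc_scale M r n * (pc_steps M r n * pc_bound M r n)).
Definition pc_width M r n := (2 * pc_range M r n).+1.
(** In order: the empty circuit, the constants 0 and K, the [M] bits, the right-hand sides, the
    perceptron steps, the final test. *)
Definition threshold_size M r n := let c0 := op_cost (pc_width M r n) in
  0 + c0 + c0 + M * c0 + n * (M.+1 * c0) + pc_steps M r n * step_cost r n c0
  + (2 * (n * pc_width M r n)).+2.

Lemma leq_step_cost r N n c : N <= n -> step_cost r N c <= step_cost r n c.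
Proof.
move=> h; rewrite /step_cost; apply: leq_add; last by rewrite leq_mul2r h orbT.
apply: leq_add; last by rewrite leq_mul2r h orbT.
by rewrite leq_add2r leq_mul2l leq_mul2r ltnS h !orbT.
Qed.

Section Threshold.
Local Open Scope ring_scope.
Variables (m M r N n : nat) (V : nat -> nat -> R) (chi : nat -> nat -> bool).
Variables (idx : nat -> nat) (phi : nat -> bool -> bool).
Hypotheses (n_gt0 : (0 < n)%N) (le_Nn : (N <= n)%N).
Hypothesis V01 : forall j l, (j < N)%N -> (l < r)%N -> 0 <= V j l <= 1.

Let K := pc_scale M r n.
Let E := pc_err M r.
Let Z := pc_bound M r n.
Let S := pc_steps M r n.
Let zeta := pc_zeta M r.

(** In the application [phi e] of input bit [idx e] says that edge [e] is missing from the graph G,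
    and [chi j] is the tour T_j, so this is |T_j \ G|. *)
Definition overlap (j : nat) (x : seq bool) : R :=
  \sum_(e < M) (chi j e)%:R * (phi e (nth false x (idx e)))%:R.

(** The equation is multiplied by 2K, which clears the 1/2, and K V is rounded down. [beta] is
    exact, so rounding affects only the coefficients of [u]. *)
Let W j l : R := (2 * Num.trunc (K%:R * V j l))%:R.
Let beta j x : R := K%:R + \sum_(e < M) - (2 * K%:R * (chi j e)%:R)
   * (phi e (nth false x (idx e)))%:R.

Lemma overlap_bound j x : `|overlap j x| <= M%:R.
Proof.
rewrite (le_trans (ler_norm_sum _ _ _)) // -[leRHS]mulr1.
apply: (@sum_le_const _ _ (fun e => `|(chi j e)%:R * (phi e (nth false x (idx e)))%:R|)).
by move=> e _; case: (chi j e); case: phi; rewrite ?mulr1 ?mulr0 ?normr0 ?normr1.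
Qed.

Lemma betaE j x : beta j x = K%:R - 2 * K%:R * overlap j x.
Proof.
rewrite /beta /overlap mulr_sumr -sumrN; congr (_ + _); apply: eq_bigr => e _.
by rewrite mulNr mulrA.
Qed.

Lemma K_gt0 : 0 < K%:R :> R. Proof. by rewrite ltr0n /K /pc_scale addn1. Qed.

Lemma W_le j l : (j < N)%N -> (l < r)%N -> `|W j l| <= (2 * K)%:R.
Proof.
move=> hj hl; have /andP[v0 v1] := V01 hj hl; rewrite ger0_norm // /W !natrM.
rewrite ler_wpM2l // (@le_trans _ _ (K%:R * V j l)) //.
  by rewrite truncn_le mulr_ge0.
by rewrite -[leRHS]mulr1 ler_wpM2l.
Qed.

Lemma W_approx j l : (j < N)%N -> (l < r)%N -> `|W j l - 2 * K%:R * V j l| <= 2.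
Proof.
move=> hj hl; have /andP[v0 v1] := V01 hj hl.
have kv0 : 0 <= K%:R * V j l by rewrite mulr_ge0.
have := truncn_itv kv0; rewrite /W natrM -natr1 => /andP[h1 h2].
rewrite ler_norml; lra.
Qed.

(** Origin of [pc_err]: [r] coefficients, each off by at most 2, times coordinates of size at most
    [M]. *)
Lemma affine_approx j x u : (j < N)%N -> in_box r M%:R u ->
  `|affine_val r W (beta^~ x) u j -
    2 * K%:R * (\sum_(l < r) V j l * u l - (overlap j x - 1 / 2))| <= E%:R.
Proof.
move=> hj hu; rewrite /affine_val betaE.
have -> : \sum_(l < r) W j l * u l + (K%:R - 2 * K%:R * overlap j x) -
   2 * K%:R * (\sum_(l < r) V j l * u l - (overlap j x - 1 / 2)) =
   \sum_(l < r) (W j l - 2 * K%:R * V j l) * u l.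
  have -> : \sum_(l < r) (W j l - 2 * K%:R * V j l) * u l =
     \sum_(l < r) W j l * u l - 2 * K%:R * \sum_(l < r) V j l * u l.
    by rewrite mulr_sumr -sumrB; apply: eq_bigr => l _; ring.
  by field.
rewrite (le_trans (ler_norm_sum _ _ _)) // /E /pc_err -mulnA mulnCA natrM.
apply: (@sum_le_const _ _ (fun l => `|(W j l - 2 * K%:R * V j l) * u l|)) => l hl.
have /andP[u0 u1] := hu l hl.
by rewrite normrM natrM ler_pM ?W_approx // ger0_norm.
Qed.

(** Origin of [pc_zeta]: K + 2KM for [beta] and 2KM for each of [r] coordinates add up to K times
    2M(r+1) + 1. *)
Lemma beta_le j x : `|beta j x| + (r * (2 * K * M))%:R <= Z%:R.
Proof.
rewrite betaE.
have h : `|K%:R - 2 * K%:R * overlap j x| <= K%:R + 2 * K%:R * M%:R.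
  rewrite (le_trans (ler_normB _ _)) // lerD // ?normrM ?normr_nat //.
  by rewrite ler_wpM2l ?overlap_bound // mulr_ge0.
rewrite (le_trans (lerD h (lexx _))) //.
rewrite /Z /pc_bound /pc_zeta -/K !(natrM, natrD) -natr1 le_eqVlt; apply/orP; left.
by apply/eqP; ring.
Qed.

Let L : R := K%:R / n%:R - E%:R.

(** [pc_scale] is at least 2nE, so rounding costs at most half of the scaled gap K/n. *)
Lemma gap_ge : K%:R <= 2 * n%:R * L /\ 0 < L.
Proof.
have n0 : 1 <= n%:R :> R by rewrite ler1n.
have hE : 2 * n%:R * E%:R <= K%:R :> R.
  rewrite -!natrM ler_nat /K /pc_scale -/E.
  apply: (@leq_trans (16 * n ^ 3 * E * pc_zeta M r)); last exact: leq_addr.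
  have z0 : (0 < pc_zeta M r)%N by rewrite /pc_zeta addn1.
  apply: leq_trans (leq_pmulr _ z0); rewrite leq_mul // leq_mul //.
  by rewrite -[leqLHS]expn1 leq_pexp2l.
have nL : n%:R * L = K%:R - n%:R * E%:R.
  by rewrite /L mulrBr mulrCA divff ?mulr1 // gt_eqF //; lra.
have hK := K_gt0; split; first by rewrite -mulrA nL; lra.
have : 0 < n%:R * L by rewrite nL; lra.
by rewrite pmulr_rgt0 //; lra.
Qed.

Lemma feasible_small x u : size x = m -> in_box r M%:R u ->
  (forall j, (j < N)%N -> \sum_(l < r) V j l * u l = overlap j x - 1 / 2) ->
  forall j, (j < N)%N -> `|perceptron r N W (beta^~ x) M%:R S j| < S%:R * L.
Proof.
move=> hx hu heq j hj.
have hE j' : (j' < N)%N -> `|affine_val r W (beta^~ x) u j'| <= E%:R.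
  by move=> hj'; have := affine_approx x hj' hu; rewrite heq // subrr mulr0 subr0.
have hZ v j' : (j' < N)%N -> in_box r M%:R v -> `|affine_val r W (beta^~ x) v j'| <= Z%:R.
  move=> hj' hv; apply: (affine_val_le (m := m) (N := N) (M := M) (w := (2 * K)%N)) => //.
    by move=> *; apply: W_le.
  by move=> *; apply: beta_le.
have := perceptron_feasible (ler0n _ M) hZ S (ler0n _ Z) (ler0n _ E) hu hE.
set Y := perceptron _ _ _ _ _ => hsum.
have hj2 : Y S j ^+ 2 <= \sum_(j < N) Y S j ^+ 2.
  rewrite (bigD1 (Ordinal hj)) //= lerDl sumr_ge0 // => i _.
  by rewrite sqr_ge0.
have [hL L0] := gap_ge.
have S0 : 0 < S%:R :> R by rewrite ltr0n /S /pc_steps addn1.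
have K0 := K_gt0.
have NR : N%:R <= n%:R :> R by rewrite ler_nat.
have n0 : 1 <= n%:R :> R by rewrite ler1n.
have KE : K%:R = 16 * n%:R ^+ 3 * E%:R * zeta%:R + 1 :> R.
  by rewrite /K /pc_scale natrD !natrM; ring.
have SE : S%:R = 8 * n%:R ^+ 3 * zeta%:R ^+ 2 + 1 :> R.
  by rewrite /S /pc_steps natrD !natrM; ring.
have ZE : Z%:R = K%:R * zeta%:R :> R by rewrite /Z /pc_bound natrM.
have SL0 : 0 <= S%:R * L by rewrite mulr_ge0 // ltW.
rewrite -ltr_sqr ?nnegrE //.
rewrite real_normK ?num_real //; apply: le_lt_trans hj2 _.
apply: le_lt_trans hsum _.
have hN : S%:R * (2 * N%:R * E%:R * (S%:R * Z%:R) + N%:R * Z%:R ^+ 2) <=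
   S%:R * (2 * n%:R * E%:R * (S%:R * Z%:R) + n%:R * Z%:R ^+ 2) :> R.
  rewrite ler_wpM2l // lerD // ?ler_wpM2r ?mulr_ge0 ?exprn_ge0 //.
  by rewrite ler_wpM2l.
apply: le_lt_trans hN _.
have hLL : K%:R ^+ 2 <= 4 * n%:R ^+ 2 * L ^+ 2.
  have -> : 4 * n%:R ^+ 2 * L ^+ 2 = (2 * n%:R * L) ^+ 2 by ring.
  by rewrite lerXn2r ?nnegrE // ltW // (lt_le_trans K0).
have n2 : 0 < 4 * n%:R ^+ 2 :> R by rewrite mulr_gt0 // exprn_gt0 //; lra.
rewrite -(ltr_pM2l n2).
apply: (@lt_le_trans _ _ (S%:R ^+ 2 * K%:R ^+ 2)); last first.
  have -> : 4 * n%:R ^+ 2 * (S%:R * L) ^+ 2 = S%:R ^+ 2 * (4 * n%:R ^+ 2 * L ^+ 2) by ring.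
  by rewrite ler_wpM2l ?exprn_ge0.
rewrite ZE.
have -> : 4 * n%:R ^+ 2 * (S%:R * (2 * n%:R * E%:R * (S%:R * (K%:R * zeta%:R)) +
    n%:R * (K%:R * zeta%:R) ^+ 2)) =
    (S%:R * K%:R) * ((8 * n%:R ^+ 3 * E%:R * zeta%:R) * S%:R +
    (4 * n%:R ^+ 3 * zeta%:R ^+ 2) * K%:R) :> R by ring.
have -> : S%:R ^+ 2 * K%:R ^+ 2 = (S%:R * K%:R) * (S%:R * K%:R) :> R by ring.
rewrite ltr_pM2l ?mulr_gt0 //.
(* With the common factor S K removed, the cross term contributes S (K-1)/2 and the square term K
   (S-1)/2, together less than S K. This is the origin of the factors 16 and 8 and of the added 1 in
   [pc_scale] and [pc_steps]. *)
have -> : 8 * n%:R ^+ 3 * E%:R * zeta%:R = (K%:R - 1) / 2 :> R by rewrite KE; field.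
have -> : 4 * n%:R ^+ 3 * zeta%:R ^+ 2 = (S%:R - 1) / 2 :> R by rewrite SE; field.
nra.
Qed.

Lemma infeasible_large x : size x = m ->
  (forall u, in_box r M%:R u -> exists2 j, (j < N)%N &
     1 / (2 * n%:R) <= `|\sum_(l < r) V j l * u l - (overlap j x - 1 / 2)|) ->
  exists2 j, (j < N)%N & S%:R * L <= `|perceptron r N W (beta^~ x) M%:R S j|.
Proof.
move=> hx h; apply: perceptron_infeasible => //; first by rewrite /S /pc_steps addn1.
have n0 : 1 <= n%:R :> R by rewrite ler1n.
have key (a b : R) : 1 / (2 * n%:R) <= `|b| -> `|a - 2 * K%:R * b| <= E%:R -> L <= `|a|.
  move=> hb hab.
  have h2 : K%:R / n%:R <= `|2 * K%:R * b|.
    rewrite normrM ger0_norm ?mulr_ge0 //.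
    have -> : K%:R / n%:R = 2 * K%:R * (1 / (2 * n%:R)) :> R.
      by field; rewrite gt_eqF //; lra.
    by rewrite ler_wpM2l ?mulr_ge0.
  have := ler_normB a (a - 2 * K%:R * b).
  have -> : a - (a - 2 * K%:R * b) = 2 * K%:R * b by ring.
  rewrite /L lerBlDr => hab2; apply: le_trans h2 _; apply: le_trans hab2 _.
  by rewrite lerD2l.
move=> u hu; have [j hj hg] := h u hu; exists j => //.
exact: key hg (affine_approx x hj hu).
Qed.

(** The output tests whether some state coordinate reaches S L in absolute value. Nothing is claimed
    for inputs with neither a solution nor a gap. *)
Lemma threshold_circuit : exists2 C, (size C <= threshold_size M r n)%N &
  forall x, size x = m ->
  (forall u, in_box r M%:R u ->
     (forall j, (j < N)%N -> \sum_(l < r) V j l * u l = overlap j x - 1 / 2) ->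
     circuit_eval C x = false) /\
  ((forall u, in_box r M%:R u -> exists2 j, (j < N)%N &
     1 / (2 * n%:R) <= `|\sum_(l < r) V j l * u l - (overlap j x - 1 / 2)|) ->
   circuit_eval C x = true).
Proof.
pose D := pc_range M r n; pose dom := small_ints D; pose c0 := op_cost (size dom).
have sdom : size dom = pc_width M r n by rewrite size_map size_iota.
have ZD : (Z <= D)%N by rewrite /D /pc_range -/Z; lia.
have KZ : (K + 2 * K * M <= Z)%N.
  by rewrite /Z /pc_bound -/K /pc_zeta; nia.
pose T0 := fun _ : seq bool -> R => False.
have hT0 : computes m dom 0 T0 by exists [::].
pose zf := (fun _ : seq bool => 0) : seq bool -> R.
pose kf := (fun _ : seq bool => K%:R) : seq bool -> R.
pose hf e (x : seq bool) : R := (phi e (nth false x (idx e)))%:R.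
have a1 : addable m dom T0 c0 zf.
  (* A constant is entered as a function of input bit 0 that ignores the bit. *)
  apply: (@addable_input _ _ _ _ _ 0 (fun=> 0)) => // _.
  by apply: mem_small_ints; rewrite ?normr0.
have a2 : addable m dom (addf T0 zf) c0 kf.
  apply: (@addable_input _ _ _ _ _ 0 (fun=> K%:R)) => // _.
  by apply: mem_small_ints; rewrite // normr_nat ler_nat; lia.
have a3 e : (e < M)%N -> addable m dom (addf (addf T0 zf) kf) c0 (hf e).
  move=> he; apply: (@addable_input _ _ _ _ _ (idx e) (fun b => (phi e b)%:R)) => // b.
  apply: mem_small_ints; first by [].
  rewrite normr_nat ler_nat (leq_trans (leq_b1 _)) //.
  by rewrite /K /pc_scale in KZ; lia.
pose T1 := addfs (addf (addf T0 zf) kf) M hf.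
have a4 j : (j < N)%N -> addable m dom T1 (M.+1 * c0) (beta j).
  move=> hj; apply: (@addable_sum _ _ _ M (fun e => - (2 * K%:R * (chi j e)%:R)) hf kf) => //.
  - by left; right.
  - by move=> e he; right; exists e.
  - by move=> e _; rewrite -!natrM rpredN natr_int.
  - by move=> e x _ _; apply: natr_int.
  - by move=> x _; apply: natr_int.
  move=> x hx; apply: (@le_trans _ _ (K%:R + M%:R * (2 * K%:R))); last first.
    by rewrite -!natrM -natrD ler_nat mulnC; lia.
  rewrite normr_nat lerD2l.
  apply: (@sum_le_const _ _ (fun e => `|- (2 * K%:R * (chi j e)%:R) * hf e x|)) => e _.
  rewrite normrM normrN normrM ger0_norm ?mulr_ge0 // -[leRHS]mulr1 -mulrA.
  rewrite ler_wpM2l ?mulr_ge0 // /hf !normr_nat -natrM (ler_nat _ _ 1).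
  by case: (chi j e); case: phi.
have c1 := computes_family a4 (computes_family a3 (a2 _ _ (fun f h => h)
   (a1 _ _ (fun f h => h) hT0))).
set T2 := addfs T1 N beta in c1.
have T20 : T2 (fun=> 0) by left; left; left; right.
have T2b j : (j < N)%N -> T2 (beta j) by move=> hj; right; exists j.
have bi j x : (j < N)%N -> size x = m -> beta j x \is a Num.int.
  move=> _ _; rewrite /beta rpredD ?natr_int // rpred_sum // => e _.
  by rewrite -!natrM rpredM ?rpredN ?natr_int.
have Dge : (M + Z + S * Z + N * (2 * K * (S * Z)) <= D)%N.
  by rewrite /D /pc_range -/Z -/S -/K leq_add2l leq_mul2r le_Nn orbT.
have c2 := computes_perceptron T20 T2b (fun j l _ _ => natr_int _ _) W_le bi
   (fun j x _ _ => beta_le j x) Dge c1.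
pose P (v : R) := S%:R * L <= `|v|.
have [|C sC hC] := @computes_exists m _ dom _ _ N (pstate r N M W beta S) P _ c2.
  by move=> j hj; right; exists j.
exists C; first apply: (leq_trans sC).
  rewrite /threshold_size -sdom -/c0.
  apply: leq_add; last by rewrite !ltnS leq_mul2l leq_mul2r le_Nn !orbT.
  apply: leq_add; first by rewrite leq_add2l leq_mul2r le_Nn orbT.
  by rewrite leq_mul2l leq_step_cost ?orbT.
move=> x hx; rewrite hC //; split=> [u hu heq|hinf].
  apply/negbTE/hasPn => j; rewrite mem_iota => /andP[_ hj].
  by rewrite /P -ltNge; apply: (feasible_small hx hu heq).
have [j hj hL] := infeasible_large hx hinf.
by apply/hasP; exists j; rewrite ?mem_iota.
Qed.

End Threshold.

(** * Farkas lemma *)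

Section Farkas.
Local Open Scope ring_scope.
Variable F : realFieldType.

(* [(a, c)] stands for the inequality [a . z <= c]. *)
Definition ineq := ((nat -> F) * F)%type.

(** No weights are tracked during the elimination; [implied_weights] recovers them by induction on
    the derivation. *)
Inductive implied (S : ineq -> Prop) : ineq -> Prop :=
| ImpliedIn p : S p -> implied S p
| ImpliedComb k p l q : 0 <= k -> 0 <= l -> implied S p -> implied S q ->
    implied S (fun j => k * p.1 j + l * q.1 j, k * p.2 + l * q.2).

Lemma implied_trans (S S' : ineq -> Prop) p :
  (forall q, S q -> implied S' q) -> implied S p -> implied S' p.
Proof. by move=> h; elim=> [q /h|k p0 l q k0 l0 _ h1 _ h2] //; apply: ImpliedComb. Qed.

Lemma all_or_ex (T : Type) (P : pred T) (s : seq T) :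
  (forall p, List.In p s -> P p) \/ (exists2 p, List.In p s & ~~ P p).
Proof.
elim: s => [|x s [IH|[p hp nP]]]; first by left.
  by have [Px|nPx] := boolP (P x); [left=> p [<-|/IH]|right; exists x; rewrite //; left].
by right; exists p; [right|].
Qed.

Lemma separating_point (ls us : seq F) :
  (forall l u, l \in ls -> u \in us -> l <= u) ->
  exists t, (forall l, l \in ls -> l <= t) /\ (forall u, u \in us -> t <= u).
Proof.
elim: ls => [|l ls IH] h.
  elim: us {h} => [|u us [t [_ IH]]]; first by exists 0.
  exists (Num.min u t); split=> // v; rewrite inE => /orP[/eqP->|/IH vt].
    by rewrite ge_min lexx.
  by rewrite ge_min vt orbT.
have [|t [tl tu]] := IH.
  by move=> l' u hl hu; apply: h => //; rewrite inE hl orbT.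
exists (Num.max l t); split=> [v|u hu].
  rewrite inE => /orP[/eqP->|/tl vt]; first by rewrite le_max lexx.
  by rewrite le_max vt orbT.
by rewrite ge_max tu // h // mem_head.
Qed.

Definition holds_at k (z : nat -> F) (p : ineq) : bool := \sum_(j < k) p.1 j * z j <= p.2.

Lemma In_mem_map (T : Type) (U : eqType) (f : T -> U) (s : seq T) x :
  List.In x s -> f x \in map f s.
Proof. by elim: s => //= y s IH [->|/IH h]; rewrite inE ?eqxx ?h ?orbT. Qed.

Lemma mem_map_In (T : Type) (U : eqType) (f : T -> U) (s : seq T) y :
  y \in map f s -> exists2 x, List.In x s & y = f x.
Proof.
elim: s => //= x s IH; rewrite inE => /orP[/eqP->|/IH[w hw ->]]; first by exists x; [left|].
by exists w; [right|].
Qed.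

Lemma In_filter (T : Type) (P : pred T) (s : seq T) x :
  List.In x (filter P s) <-> List.In x s /\ P x.
Proof.
elim: s => [|y s IH] /=; first by split=> [|[]].
case: ifP => Py /=; split.
- by move=> [<-|/IH[]]; [split; [left|]|split; [right|]].
- by move=> [[->|h] Px]; [left|right; apply/IH].
- by move=> /IH[]; split; [right|].
- by move=> [[e|h] Px]; [rewrite e Px in Py|apply/IH].
Qed.

Lemma In_cat (T : Type) (s t : seq T) x :
  List.In x (s ++ t) <-> List.In x s \/ List.In x t.
Proof. by split=> [/(@List.in_app_or T)|/(@List.in_or_app T)]. Qed.

Lemma In_allpairs (T1 T2 U : Type) (f : T1 -> T2 -> U) (s : seq T1) (t : seq T2) y :
  List.In y [seq f a b | a <- s, b <- t] <->
  exists a b, [/\ List.In a s, List.In b t & y = f a b].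
Proof.
elim: s => [|a s IH]; first by split=> // [[a [b []]]].
rewrite /= In_cat IH; split.
  move=> [/(@List.in_map_iff T2 U)[b [<- hb]]|[a' [b [h1 h2 ->]]]].
    by exists a, b; split=> //; left.
  by exists a', b; split=> //; right.
move=> [a' [b [[<-|h1] h2 ->]]]; last by right; exists a', b.
by left; apply/(@List.in_map_iff T2 U); exists b.
Qed.

(** Coordinate [k] is eliminated: inequalities free of it are kept, and each upper bound on it is
    added to each lower bound with weights that cancel it. A solution of the reduced system extends,
    because then every lower bound is below every upper bound. *)
Lemma fourier_motzkin k (s : seq ineq) :
  (forall z, ~ forall p, List.In p s -> holds_at k z p) ->
  exists p, [/\ implied (fun q => List.In q s) p, forall j, (j < k)%N -> p.1 j = 0 & p.2 < 0].
Proof.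
elim: k s => [|k IH] s hs.
  have [h|[p hp]] := all_or_ex (fun p : ineq => 0 <= p.2) s.
    by case: (hs (fun=> 0)) => p /h; rewrite /holds_at big_ord0.
  by rewrite -ltNge => p0; exists p; split=> //; apply: ImpliedIn.
pose zs := [seq p <- s | p.1 k == 0].
pose us := [seq p <- s | 0 < p.1 k]; pose ls := [seq p <- s | p.1 k < 0].
pose comb (p q : ineq) : ineq :=
  (fun j => (- q.1 k) * p.1 j + p.1 k * q.1 j, (- q.1 k) * p.2 + p.1 k * q.2).
pose s' := zs ++ [seq comb p q | p <- us, q <- ls].
have s'0 p : List.In p s' -> p.1 k = 0.
  rewrite In_cat => -[/In_filter[_ /eqP]//|/In_allpairs[u [l [_ _ ->]]]] /=.
  by rewrite mulrC mulrN addrC subrr.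
have [|p [hp p0 pneg]] := IH s'.
  move=> z hz.
  pose rest (p : ineq) := (p.2 - \sum_(j < k) p.1 j * z j) / p.1 k.
  have [|t [tl tu]] := @separating_point (map rest ls) (map rest us).
    move=> _ _ /mem_map_In[l hl ->] /mem_map_In[u hu ->].
    have /In_filter[_ l0] := hl; have /In_filter[_ u0] := hu.
    have : holds_at k z (comb u l).
      by apply: hz; rewrite In_cat; right; apply/In_allpairs; exists u, l.
    rewrite /holds_at /=.
    have -> : \sum_(j < k) (- l.1 k * u.1 j + u.1 k * l.1 j) * z j =
       - l.1 k * (\sum_(j < k) u.1 j * z j) + u.1 k * (\sum_(j < k) l.1 j * z j).
      by rewrite !mulr_sumr -big_split /=; apply: eq_bigr => j _; ring.
    rewrite /rest; move: (\sum_(j < k) u.1 j * z j) (\sum_(j < k) l.1 j * z j) => a b h.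
    rewrite ler_ndivrMr // mulrAC ler_pdivrMr //; nra.
  apply: (hs (fun j => if j == k then t else z j)) => p hp; rewrite /holds_at.
  rewrite big_ord_recr /= eqxx.
  have -> : \sum_(j < k) p.1 j * (if j == k :> nat then t else z j) =
      \sum_(j < k) p.1 j * z j.
    by apply: eq_bigr => j _; rewrite ltn_eqF.
  have [p0|p0|/eqP p0] := ltgtP (p.1 k) 0.
  - have : rest p <= t by apply/tl/In_mem_map/In_filter.
    by rewrite /rest ler_ndivrMr // mulrC; lra.
  - have : t <= rest p by apply/tu/In_mem_map/In_filter.
    by rewrite /rest ler_pdivlMr // mulrC; lra.
  rewrite (eqP p0) mul0r addr0; apply: hz; rewrite In_cat; left; exact/In_filter.
exists p; split=> //.
  apply: implied_trans hp => q; rewrite In_cat => -[/In_filter[hq _]|].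
    exact: ImpliedIn.
  move=> /In_allpairs[u [l [/In_filter[hu u0] /In_filter[hl l0] ->]]].
  apply: ImpliedComb; rewrite ?oppr_ge0 ?ltW //; exact: ImpliedIn.
move=> j; rewrite ltnS leq_eqVlt => /orP[/eqP->|/p0//].
(* All members of [s'] have coefficient 0 at [k], and combinations inherit this. *)
elim: hp => [q /s'0//|a q b q' _ _ _ h1 _ h2] /=.
by rewrite h1 h2 !mulr0 addr0.
Qed.

Lemma implied_weights (I : finType) (f : I -> ineq) p :
  implied (fun q => exists i, q = f i) p ->
  exists u : I -> F, [/\ forall i, 0 <= u i, forall j, p.1 j = \sum_i u i * (f i).1 j
     & p.2 = \sum_i u i * (f i).2].
Proof.
have D (i : I) (h : I -> F) : h i = \sum_i' (i' == i)%:R * h i'.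
  rewrite (bigD1 i) //= eqxx mul1r big1 ?addr0 // => j /negPf->; exact: mul0r.
elim=> [q [i ->]|k q l q' k0 l0 _ [u [u0 u1 u2]] _ [v [v0 v1 v2]]].
  exists (fun i' => (i' == i)%:R); split; first by [].
    by move=> j; rewrite [LHS](D i (fun i => (f i).1 j)).
  by rewrite [LHS](D i (fun i => (f i).2)).
exists (fun i => k * u i + l * v i); split=> [i|j|] /=.
- by rewrite addr_ge0 // mulr_ge0.
- rewrite u1 v1 !mulr_sumr -big_split /=; apply: eq_bigr => i _; ring.
- rewrite u2 v2 !mulr_sumr -big_split /=; apply: eq_bigr => i _; ring.
Qed.

Lemma farkas p k (M : 'M[F]_(p, k)) (c : 'cV[F]_p) :
  (forall z : 'cV[F]_k, ~ forall i, (M *m z) i ord0 <= c i ord0) ->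
  exists u : 'rV[F]_p, [/\ forall i, 0 <= u ord0 i, u *m M = 0 & (u *m c) ord0 ord0 < 0].
Proof.
move=> h.
pose f (i : 'I_p) : ineq := (fun j => if insub j is Some j' then M i j' else 0, c i ord0).
have [|q [hq q0 qneg]] := @fourier_motzkin k (map f (enum 'I_p)).
  move=> z hz; apply: (h (\col_j z j)) => i.
  have : holds_at k z (f i).
    apply: hz; apply: List.in_map.
    have : i \in enum 'I_p by rewrite mem_enum.
    by elim: (enum _) => //= a l IH; rewrite inE => /orP[/eqP->|/IH]; [left|right].
  rewrite /holds_at mxE /=; congr (_ <= _); apply: eq_bigr => j _.
  by rewrite valK mxE.
have {hq} : implied (fun q => exists i, q = f i) q.
  apply: implied_trans hq => q' /(@List.in_map_iff _ _ f)[i [<- _]].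
  by apply: ImpliedIn; exists i.
move=> /implied_weights[u [u0 u1 u2]].
exists (\row_i u i); split.
- by move=> i; rewrite mxE.
- apply/rowP => j; rewrite !mxE -[RHS](q0 j) // u1.
  by apply: eq_bigr => i _; rewrite mxE /= valK.
- rewrite mxE; move: qneg; rewrite u2; congr (_ < _).
  by apply: eq_bigr => i _; rewrite mxE.
Qed.

End Farkas.

(** * Slack factorizations and barycentric spanners *)

Section Factorization.
Local Open Scope ring_scope.
Variable F : realFieldType.

(** For each [j] the formulation together with g_j x <= c is infeasible. Its Farkas multipliers
    satisfy ul A = - la g_j and ul B = 0, so ul / la applied to the slack of chi_i gives g_j chi_i
    plus a constant. The extra coordinate, where [V] is 1, corrects this constant to -c. *)
Lemma slack_factorization (I J : finType) P m (A : 'M[F]_(P, m)) (B : 'M[F]_(P, P))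
    (b : 'cV[F]_P) (chi : I -> 'cV[F]_m) (g : J -> 'rV[F]_m) (i0 : I) (c : F) :
  (forall i, exists y : 'cV[F]_P, forall k, (A *m chi i + B *m y) k ord0 <= b k ord0) ->
  (forall j x (y : 'cV[F]_P), (forall k, (A *m x + B *m y) k ord0 <= b k ord0) ->
     c < (g j *m x) ord0 ord0) ->
  exists (U : J -> 'I_(P + 1) -> F) (V : I -> 'I_(P + 1) -> F),
    [/\ forall j l, 0 <= U j l, forall i l, 0 <= V i l &
        forall i j, \sum_l U j l * V i l = (g j *m chi i) ord0 ord0 - c].
Proof.
move=> /fin_all_exists[y hy] hg.
have scale11 (a : F) (X : 'M[F]_1) : (a *: X) ord0 ord0 = a * X ord0 ord0 by rewrite mxE.
pose V i : 'cV[F]_(P + 1) := col_mx (b - (A *m chi i + B *m y i)) 1%:M.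
have V0 i l : 0 <= V i l ord0.
  rewrite !mxE; case: split => k; last by rewrite mxE ler0n.
  by have := hy i k; rewrite !mxE subr_ge0.
have /fin_all_exists[U hU] j : exists u : 'rV[F]_(P + 1), (forall l, 0 <= u ord0 l) /\
    forall i, (u *m V i) ord0 ord0 = (g j *m chi i) ord0 ord0 - c.
  pose M := col_mx (row_mx A B) (row_mx (g j) 0).
  have [z hz|u [u0 uM uc]] := @farkas F _ _ M (col_mx b c%:M).
    have := hz; rewrite -[z]vsubmxK /M mul_col_mx !mul_row_col => hz'.
    have /(hg j) : forall k, (A *m usubmx z + B *m dsubmx z) k ord0 <= b k ord0.
      by move=> k; have := hz' (lshift 1 k); rewrite !col_mxEu.
    have := hz' (rshift P ord0); rewrite !col_mxEd mul0mx addr0 [c%:M _ _]mxE eqxx mulr1n.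
    by move=> h1 h2; have := le_lt_trans h1 h2; rewrite ltxx.
  move: uM uc; rewrite -[u]hsubmxK /M mul_row_col !mul_mx_row add_row_mx mul_row_col.
  rewrite -[0 in RHS]row_mx0 mulmx0 addr0.
  set ul := lsubmx u; set ur := rsubmx u => /eq_row_mx[uA uB] uc.
  pose la := ur ord0 ord0.
  have ur_la : ur = la%:M by exact: mx11_scalar.
  have la0 : 0 <= la by rewrite /la mxE.
  have eqA x : ul *m (A *m x) = - (la *: (g j *m x)).
    apply/eqP; rewrite -subr_eq0 opprK mulmxA; apply/eqP.
    by rewrite -mul_scalar_mx -ur_la mulmxA -mulmxDl uA mul0mx.
  have eqB x : ul *m (B *m x) = 0 by rewrite mulmxA uB mul0mx.
  have ulge (w : 'cV[F]_P) : (forall k, 0 <= w k ord0) -> 0 <= (ul *m w) ord0 ord0.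
    by move=> w0; rewrite mxE sumr_ge0 // => k _; rewrite mulr_ge0 // /ul mxE.
  have ub : (ul *m b) ord0 ord0 + la * c < 0.
    by move: uc; rewrite ur_la mul_scalar_mx !mxE eqxx mulr1n.
  have key i : 0 <= (ul *m b) ord0 ord0 + la * (g j *m chi i) ord0 ord0.
    have : 0 <= (ul *m (b - (A *m chi i + B *m y i))) ord0 ord0.
      by apply: ulge => k; have := hy i k; rewrite !mxE subr_ge0.
    rewrite mulmxBr mulmxDr eqA eqB addr0 opprK mxE.
    by rewrite scale11.
  (* If [la] were 0, the multipliers would refute the formulation itself, which is feasible at
     [i0]. *)
  have lap : 0 < la.
    rewrite lt_neqAle la0 andbT eq_sym; apply/eqP => l0.
    by have := key i0; move: ub; rewrite l0 !mul0r !addr0 => /lt_le_trans h /h; rewrite ltxx.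
  exists (row_mx (la^-1 *: ul) (- c - la^-1 * (ul *m b) ord0 ord0)%:M); split.
    move=> l; rewrite mxE; case: split => k.
      by rewrite !mxE mulr_ge0 // ?invr_ge0.
    rewrite !ord1 mxE eqxx mulr1n -(pmulr_rge0 _ lap) mulrBr mulrA divff ?gt_eqF //.
    by rewrite mul1r; lra.
  move=> i; rewrite /V mul_row_col mul_scalar_mx -scalemxAl mulmxBr mulmxDr eqA eqB.
  rewrite addr0 opprK; set gx := g j *m chi i; set ubb := ul *m b.
  rewrite !mxE eqxx mulr1n mulr1 mulrDr mulrA mulVf ?gt_eqF //.
  by ring.
exists (fun j l => U j ord0 l), (fun i l => V i l ord0); split=> //.
  by move=> j l; have [h _] := hU j.
by move=> i j; have [_ <-] := hU j; rewrite mxE.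
Qed.

(** Coordinate [l] of [V] is divided by its maximum [nu l], and that of [U] multiplied by it. At the
    maximizer, the product of [U j l] and [nu l] is one term of a nonnegative sum that equals an
    entry of [s]. If [nu l] is 0, division by 0 yields 0 and the term vanishes on both sides. *)
Lemma bounded_factorization (I J : finType) r (U : J -> 'I_r -> F) (V : I -> 'I_r -> F)
    (s : J -> I -> F) (M : F) (i0 : I) :
  (forall j l, 0 <= U j l) -> (forall i l, 0 <= V i l) ->
  (forall i j, \sum_l U j l * V i l = s j i) -> (forall i j, s j i <= M) -> 0 <= M ->
  exists (U' : J -> 'I_r -> F) (V' : I -> 'I_r -> F),
    [/\ forall j l, 0 <= U' j l <= M, forall i l, 0 <= V' i l <= 1 &
        forall i j, \sum_l U' j l * V' i l = s j i].
Proof.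
move=> U0 V0 hs sM M0.
pose am l := [arg max_(i > i0) V i l]%O; pose nu l := V (am l) l.
have nuP l i : V i l <= nu l by rewrite /nu /am; case: arg_maxP => // k _; apply.
have nu0 l : 0 <= nu l by apply: V0.
exists (fun j l => U j l * nu l), (fun i l => V i l / nu l); split.
- move=> j l; rewrite mulr_ge0 ?U0 ?nu0 //=; apply: le_trans (sM (am l) j).
  by rewrite -hs (bigD1 l) //= lerDl sumr_ge0 // => k _; rewrite mulr_ge0.
- move=> i l; rewrite divr_ge0 ?V0 ?nu0 //=; have [n0|n0] := eqVneq (nu l) 0.
    by rewrite n0 invr0 mulr0.
  by rewrite ler_pdivrMr ?mul1r // lt_neqAle eq_sym n0 V0.
move=> i j; rewrite -hs; apply: eq_bigr => l _.
have [n0|n0] := eqVneq (nu l) 0.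
  have -> : V i l = 0 by apply/eqP; rewrite eq_le V0 -n0 nuP.
  by rewrite n0 mul0r mulr0 mulr0.
by rewrite mulrACA [nu l * _]mulrC mulrA mulrAC -mulrA divff // mulr1.
Qed.

(** Rows are chosen with maximal absolute determinant with respect to a column basis. By Cramer's
    rule the coefficients of any row are quotients of such a determinant by the maximal one. *)
Lemma barycentric_spanner t N (W : 'M[F]_(t, N)) :
  exists k (f : 'I_k -> 'I_t), (k <= N)%N /\
    forall i, exists c : 'rV[F]_k, (forall j, `|c ord0 j| <= 1) /\
      row i W = c *m rowsub f W.
Proof.
pose k := \rank W; pose C : 'M[F]_(t, k) := col_base W.
pose D (f : {ffun 'I_k -> 'I_t}) := rowsub f C.
have fC : row_full C by apply: col_base_full.
pose f0 : {ffun 'I_k -> 'I_t} := [ffun j => fullrankfun fC j].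
have u0 : \det (D f0) != 0.
  have -> : D f0 = rowsub (fullrankfun fC) C.
    by apply/matrixP => a b; rewrite !mxE ffunE.
  by rewrite -unitfE -unitmxE fullrowsub_unit.
pose f := [arg max_(f > f0) `|\det (D f)|]%O.
have fmax f' : `|\det (D f')| <= `|\det (D f)|.
  by rewrite /f; case: arg_maxP => // h _; apply.
have df : \det (D f) != 0 by rewrite -normr_gt0 (lt_le_trans _ (fmax f0)) // normr_gt0.
have uf : D f \in unitmx by rewrite unitmxE unitfE.
exists k, f; split; first exact: rank_leq_col.
move=> i; exists (row i C *m invmx (D f)); split; last first.
  rewrite -{2}(mulmx_base W) -mul_rowsub_mx -/C -/(D f) mulmxA mulmxKV //.
  by rewrite -row_mul mulmx_base.
move=> j.
pose f' : {ffun 'I_k -> 'I_t} := [ffun l => if l == j then i else f l].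
have -> : (row i C *m invmx (D f)) ord0 j = \det (D f') / \det (D f).
  rewrite /invmx uf -scalemxAr mxE mulrC; congr (_ / _).
  (* Replacing row [j] leaves the cofactors along that row unchanged. *)
  rewrite (expand_det_row _ j) mxE; apply: eq_bigr => l _.
  rewrite !mxE ffunE eqxx /cofactor; congr (_ * (_ * \det _)).
  by apply/matrixP => a b; rewrite !mxE ffunE eq_sym (negPf (neq_lift _ _)).
by rewrite normrM normfV ler_pdivrMr ?normr_gt0 // mul1r.
Qed.

End Factorization.

(** * Circuits from extended formulations *)

Definition avoids (M : nat) (s : seq bool) (g : nat -> bool) : Prop :=
  forall e, e < M -> nth false s e -> ~~ g e.

Section CoverCircuit.
Local Open Scope ring_scope.

Lemma row_mul_bitvec M (g : 'rV[R]_M) s :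
  (g *m bitvec M s) ord0 ord0 = \sum_(e < M) g ord0 e * (nth false s e)%:R.
Proof. by rewrite mxE; apply: eq_bigr => e _; rewrite mxE. Qed.

Lemma nat_of_bool_sum_ge1 M (s : seq bool) (g : nat -> bool) : ~ avoids M s g ->
  1 <= \sum_(e < M) (g e)%:R * (nth false s e)%:R :> R.
Proof.
have [h nav|[e _ h] _] := all_or_ex (fun e : 'I_M => ~~ (nth false s e && g e)) (enum 'I_M).
  have {}h e : e \in enum 'I_M -> ~~ (nth false s e && g e).
    move=> he; apply: h; elim: (enum _) he => //= a l IH.
    by rewrite inE => /orP[/eqP->|/IH]; [left|right].
  case: nav => e he se; have := h (Ordinal he); rewrite mem_enum /= => /(_ isT).
  by rewrite se.
have /andP[se ge] := negbNE h.
rewrite (bigD1 e) //=.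
have -> : (g e)%:R * (nth false s e)%:R = 1 :> R by rewrite se ge mulr1.
by rewrite lerDl sumr_ge0 // => k _; rewrite mulr_ge0.
Qed.

Lemma avoids_sum M (s : seq bool) (g : nat -> bool) : avoids M s g ->
  \sum_(e < M) (g e)%:R * (nth false s e)%:R = 0 :> R.
Proof.
move=> h; rewrite big1 // => e _; have := h e (ltn_ord e).
by case: nth => [/(_ isT)/negPf->|_]; rewrite ?mul0r ?mulr0.
Qed.

(** The argument is not specific to tours: it takes a nonempty slice with a small formulation. The
    circuit detects that the spanner equations have no solution, which means that some member avoids
    the forbidden coordinates. *)
Lemma cover_circuit (T : language) M P (A : 'M[R]_(P, M)) (B : 'M[R]_(P, P))
    (b : 'cV[R]_P) (m : nat) (idx : nat -> nat) (phi : nat -> bool -> bool) :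
  (forall x : 'cV[R]_M, conv (@slice T M) x <->
     exists y : 'cV[R]_P, forall i, (A *m x + B *m y) i ord0 <= b i ord0) ->
  (exists s, T s /\ size s = M) ->
  exists2 C, (size C <= threshold_size M (P + 1) (P + 1 + (1 + M)).+1)%N &
    forall x, size x = m -> (circuit_eval C x <->
      exists s, [/\ T s, size s = M & avoids M s (fun e => phi e (nth false x (idx e)))]).
Proof.
move=> hCF [s0 [Ts0 ss0]].
pose I : finType := {s : M.-tuple bool | `[< T s >]}.
(* [J] consists of the sets that meet every member of the slice: for tours, the complements of
   non-Hamiltonian graphs. *)
pose J : finType := {g : M.-tuple bool |
  `[< forall s, T s -> size s = M -> ~ avoids M s (nth false g) >]}.
pose i0 : I := exist _ (tcast ss0 (in_tuple s0))
  (asboolT (eq_ind_r T Ts0 (val_tcast ss0 (in_tuple s0)))).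
pose chi (i : I) : 'cV[R]_M := bitvec M (val i).
pose g (j : J) : 'rV[R]_M := \row_e (nth false (val j) e)%:R.
have gchi (j : J) s : (g j *m bitvec M s) ord0 ord0 =
    \sum_(e < M) (nth false (val j) e)%:R * (nth false s e)%:R.
  by rewrite row_mul_bitvec; apply: eq_bigr => e _; rewrite mxE.
have hI (i : I) : exists y : 'cV[R]_P, forall k, (A *m chi i + B *m y) k ord0 <= b k ord0.
  apply/hCF; exists 1%N, (fun=> chi i), (fun=> 1); split; [|split; [by []|]].
    move=> _; exists (val i); split; first by have /asboolP := valP i.
    by rewrite size_tuple.
  by rewrite !big_ord1 scale1r.
have hJ (j : J) x (y : 'cV[R]_P) : (forall k, (A *m x + B *m y) k ord0 <= b k ord0) ->
    1 / 2 < (g j *m x) ord0 ord0.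
  move=> hy; have /hCF : exists y : 'cV[R]_P,
    forall k, (A *m x + B *m y) k ord0 <= b k ord0 by exists y.
  move=> [k [pts [lam [hpts [lam0 [lam1 ->]]]]]].
  (* A blocking set has value at least 1 on every point of the slice, hence on convex
     combinations. *)
  apply: (@lt_le_trans _ _ 1); first by lra.
  rewrite -lam1 mulmx_sumr summxE; apply: ler_sum => a _.
  have [s [Ts [ss ->]]] := hpts a.
  rewrite -scalemxAr mxE gchi -[leLHS]mulr1 ler_wpM2l //.
  by apply: nat_of_bool_sum_ge1; have /asboolP := valP j; apply.
have [U0 [V0 [U0pos V0pos UV0]]] := slack_factorization i0 hI hJ.
have [|U [V [U01 V01 UV]]] := bounded_factorization i0 U0pos V0pos UV0 _ (ler0n _ M).
  move=> i j; rewrite gchi.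
  have : \sum_(e < M) (nth false (val j) e)%:R * (nth false (val i) e)%:R <= M%:R * 1 :> R.
    apply: (@sum_le_const _ _ (fun e => (nth false (val j) e)%:R * (nth false (val i) e)%:R)).
    by move=> e _; rewrite -natrM (ler_nat _ _ 1); case: nth; case: nth.
  by lra.
(* Columns for the factor [V], for the constant 1 and for the characteristic vector. *)
pose N0 := (P + 1 + (1 + M))%N.
pose W : 'M[R]_(#|I|, N0) := \matrix_(a, q)
  (row_mx (\row_l V (enum_val a) l) (row_mx 1%:M (chi (enum_val a))^T) : 'rV_N0) ord0 q.
have [k [f [kN hspan]]] := barycentric_spanner W.
pose fi (j : nat) : I := if insub j is Some j' then enum_val (f j') else i0.
pose Vn j l := if insub l is Some l' then V (fi j) l' else 0.
pose chin j e := nth false (val (fi j)) e.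
have Vn01 j l : (j < k)%N -> (l < P + 1)%N -> 0 <= Vn j l <= 1.
  by move=> _ hl; rewrite /Vn insubT.
(* The gap is taken for N0 + 1 > k, so that k residuals below it add up to strictly less than
   1/2. *)
have [C sC hC] := @threshold_circuit m M (P + 1) k N0.+1 Vn chin idx phi
  (ltn0Sn _) (leqW kN) Vn01.
exists C => // x hx; have [hno hyes] := hC x hx.
pose gx e := phi e (nth false x (idx e)).
have over j : overlap M chin idx phi j x = \sum_(e < M) (gx e)%:R * (nth false (val (fi j)) e)%:R.
  by apply: eq_bigr => e _; rewrite mulrC.
have [[s [Ts ss hs]]|hns] := pselect (exists s, [/\ T s, size s = M & avoids M s gx]).
  split=> [_|_]; first by exists s.
  apply: hyes => u hu.
  pose i : I := exist _ (tcast ss (in_tuple s))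
    (asboolT (eq_ind_r T Ts (val_tcast ss (in_tuple s)))).
  have vi : val (val i) = s by rewrite /= val_tcast.
  have [c [c1 hc]] := hspan (enum_rank i).
  pose err j := \sum_(l < P + 1) Vn j l * u l - (overlap M chin idx phi j x - 1 / 2).
  have ent q : W (enum_rank i) q = \sum_j c ord0 j * W (f j) q.
    have := congr1 (fun X : 'rV_N0 => X ord0 q) hc; rewrite !mxE => ->.
    by apply: eq_bigr => j _; rewrite !mxE.
  have entV l : V i l = \sum_j c ord0 j * V (enum_val (f j)) l.
    have := ent (lshift _ l); rewrite mxE enum_rankK row_mxEl mxE => ->.
    by apply: eq_bigr => j _; rewrite mxE row_mxEl mxE.
  have ent1 : 1 = \sum_j c ord0 j.
    have := ent (rshift _ (lshift _ ord0)); rewrite mxE row_mxEr row_mxEl mxE eqxx => e1.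
    transitivity (true%:R : R); [by []|rewrite e1].
    by apply: eq_bigr => j _; rewrite mxE row_mxEr row_mxEl mxE eqxx mulr1.
  have entC (e : 'I_M) :
      (nth false s e)%:R = \sum_j c ord0 j * (nth false (val (fi j)) e)%:R :> R.
    have := ent (rshift _ (rshift _ e)); rewrite mxE enum_rankK !row_mxEr !mxE vi => ->.
    by apply: eq_bigr => j _; rewrite mxE !row_mxEr !mxE /fi valK.
  (* The combination that expresses row [i] carries the residuals of the spanner to the residual of
     [s], whose overlap with the missing edges is 0. The constant column makes the coefficients sum
     to 1, which preserves the 1/2. *)
  have sum_err : \sum_(j < k) c ord0 j * err j = \sum_(l < P + 1) V i l * u l + 1 / 2.
    transitivity (\sum_(j < k) \sum_(l < P + 1) c ord0 j * V (fi j) l * u l -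
       \sum_(j < k) \sum_(e < M) (gx e)%:R * (c ord0 j * (nth false (val (fi j)) e)%:R) +
       \sum_(j < k) c ord0 j * (1 / 2)).
      rewrite -sumrB -big_split /=; apply: eq_bigr => j _.
      rewrite /err over mulrBr mulrBr opprB addrA addrAC; congr (_ - _ + _).
        by rewrite mulr_sumr; apply: eq_bigr => l _; rewrite /Vn valK mulrA.
      by rewrite mulr_sumr; apply: eq_bigr => e _; rewrite mulrCA.
    rewrite -mulr_suml -ent1 mul1r; congr (_ + _).
    rewrite exchange_big [X in _ - X]exchange_big /=.
    rewrite [X in _ - X](_ : _ = 0) ?subr0; last first.
      rewrite -[RHS](avoids_sum hs); apply: eq_bigr => e _.
      by rewrite -mulr_sumr -entC.
    apply: eq_bigr => l _; rewrite -mulr_suml entV; congr (_ * _).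
    by apply: eq_bigr => j _; rewrite /fi valK.
  have [h|[j _ hj]] := all_or_ex (fun j : 'I_k => `|err j| < 1 / (2 * N0.+1%:R)) (enum 'I_k).
    have {}h (j : 'I_k) : `|err j| < 1 / (2 * N0.+1%:R).
      apply: h; have : j \in enum 'I_k by rewrite mem_enum.
      by elim: (enum _) => //= a l IH; rewrite inE => /orP[/eqP->|/IH]; [left|right].
    have u0 : 0 <= \sum_(l < P + 1) V i l * u l.
      rewrite sumr_ge0 // => l _; have /andP[v0 _] := V01 i l.
      by have /andP[ul0 _] := hu l (ltn_ord l); rewrite mulr_ge0.
    have : \sum_(j < k) c ord0 j * err j <= k%:R * (1 / (2 * N0.+1%:R)).
      rewrite mulr_natl -[X in _ *+ X]card_ord -sumr_const; apply: ler_sum => j _.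
      rewrite (le_trans (ler_norm _)) // normrM -[leRHS]mul1r ler_pM //.
      by rewrite ltW.
    have kN' : k%:R <= N0%:R :> R by rewrite ler_nat.
    have N00 : 0 < N0.+1%:R :> R by [].
    have : k%:R * (1 / (2 * N0.+1%:R)) < 1 / 2 :> R.
      rewrite mul1r ltr_pdivrMr; last by rewrite mulr_gt0.
      rewrite mulrA divfK ?pnatr_eq0 // mul1r.
      by apply: le_lt_trans kN' _; rewrite ltr_nat.
    by rewrite sum_err => /le_lt_trans h1 /h1; rewrite gtrDr ltNge u0.
  by exists j; rewrite // leNgt.
split=> [|//]; suff -> : circuit_eval C x = false by [].
(* Without an avoiding member, the forbidden coordinates of [x] form an element [j] of [J], and
   [U j] solves the equations exactly. *)
have hg : forall s, T s -> size s = M ->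
    ~ avoids M s (nth false (mktuple (fun e : 'I_M => gx e))).
  move=> s Ts ss hs; apply: hns; exists s; split=> // e he /(hs e he).
  by rewrite (nth_mktuple (fun e : 'I_M => gx e) false (Ordinal he)).
pose j : J := exist _ (mktuple (fun e : 'I_M => gx e)) (asboolT hg).
apply: (hno (fun l => if insub l is Some l' then U j l' else 0)).
  by move=> l hl; rewrite insubT.
move=> a ha; rewrite over; transitivity (\sum_l U j l * V (fi a) l).
  by apply: eq_bigr => l _; rewrite /Vn valK mulrC.
rewrite UV gchi; congr (_ - _); apply: eq_bigr => e _.
by rewrite (nth_mktuple (fun e : 'I_M => gx e) false e).
Qed.

End CoverCircuit.

(** * Tours as Hamiltonian cycles *)

Definition ham_cycle (V : finType) (e : rel V) (p : seq V) : Prop :=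
  [/\ uniq p, forall v, v \in p & cycle e p].

Lemma ham_cycle_size (V : finType) (e : rel V) p : ham_cycle e p -> size p = #|V|.
Proof.
move=> [up allp _]; rewrite -(card_uniqP up); apply: eq_card => v.
by rewrite allp.
Qed.

Lemma cycle_nthP (V : eqType) (e : rel V) (d : V) (p : seq V) :
  reflect (forall k, k < size p -> e (nth d p k) (nth d p (k.+1 %% size p))) (cycle e p).
Proof.
case: p => [|x q] /=; first by left.
apply: (iffP (pathP d)); rewrite size_rcons => h k hk.
  have := h k hk; rewrite -rcons_cons nth_rcons /= hk.
  rewrite nth_rcons; move: hk; rewrite ltnS leq_eqVlt => /orP[/eqP->|hk].
    by rewrite ltnn eqxx modnn.
  by rewrite hk modn_small.
have := h k hk; rewrite -rcons_cons nth_rcons /= hk.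
rewrite nth_rcons; move: hk; rewrite ltnS leq_eqVlt => /orP[/eqP->|hk].
  by rewrite ltnn eqxx modnn.
by rewrite hk modn_small.
Qed.

Lemma mem_edges n i j : ((i, j) \in edges n) = (i < j < n).
Proof.
apply/allpairsPdep/idP => [[a [b []]]|/andP[ij jn]].
  by rewrite !mem_iota => ha hb [-> ->]; lia.
by exists i, j; split; rewrite ?mem_iota //; lia.
Qed.

Lemma double_size_edges n : 2 * size (edges n) = n * n.-1.
Proof.
have -> : size (edges n) = \sum_(i < n) (n - i.+1).
  rewrite /edges size_allpairs_dep sumnE big_map -[in LHS](subn0 n) -/(index_iota 0 n) big_mkord.
  by apply: eq_bigr => i _; rewrite size_iota subn0.
rewrite -(big_mkord xpredT (fun i => n - i.+1)) big_nat_rev /= big_mkord.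
rewrite (eq_bigr (fun i : 'I_n => val i)); last by move=> i _ /=; have := ltn_ord i; lia.
elim: n => [|n IH]; first by rewrite big_ord0.
rewrite big_ord_recr /= mulnDr IH; case: n {IH} => //= n; lia.
Qed.

(** A word of [TSP] does not record its number of nodes; this recovers it from the length. *)
Lemma size_edges_inj n n' : 3 <= n -> 3 <= n' -> size (edges n) = size (edges n') -> n = n'.
Proof.
move=> hn hn' h; have := double_size_edges n; rewrite h double_size_edges.
case: n n' hn hn' {h} => [|n] [|n'] //= _ _; nia.
Qed.

Section TSPHamilton.
Variables (V : finType) (r : rel V) (v0 : V).
Hypotheses (r_sym : symmetric r) (V_ge3 : 3 <= #|V|).
Let n := #|V|.
Let ev i := nth v0 (enum V) i.

Definition missing k := ~~ r (ev (nth (0, 0) (edges n) k).1) (ev (nth (0, 0) (edges n) k).2).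

Lemma avoids_cycle_edges t : avoids (size (edges n)) [seq cycle_edge n t e.1 e.2 | e <- edges n] missing
  <-> forall i j, i < j < n -> cycle_edge n t i j -> r (ev i) (ev j).
Proof.
split=> [h i j hij hc|h k hk].
  have hi : (i, j) \in edges n by rewrite mem_edges.
  have hk : index (i, j) (edges n) < size (edges n) by rewrite index_mem.
  have := h _ hk; rewrite (nth_map (0, 0)) // /missing nth_index //= => /(_ hc).
  by rewrite negbK.
rewrite (nth_map (0, 0)) // /missing negbK.
have := mem_nth (0, 0) hk; case: nth => i j /=; rewrite mem_edges; exact: h.
Qed.

Lemma TSP_ham_cycle :
  (exists s, [/\ TSP s, size s = size (edges n) & avoids (size (edges n)) s missing])
  <-> exists p, ham_cycle r p.
Proof.
have hn : size (enum V) = n by rewrite -cardE.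
split=> [[s [[n' [t [n'3 [pt es]]]] ss hs]]|[p hp]].
  have en : n' = n.
    by apply: size_edges_inj => //; rewrite -ss es size_map.
  subst n' s; move/avoids_cycle_edges: hs => hs.
  have st : size t = n by rewrite (perm_size pt) size_iota.
  have ut : uniq t by rewrite (perm_uniq pt) iota_uniq.
  have mt i : (i \in t) = (i < n) by rewrite (perm_mem pt) mem_iota.
  exists (map ev t); split.
  - rewrite map_inj_in_uniq // => i j; rewrite !mt => hi hj /eqP.
    by rewrite nth_uniq ?enum_uniq ?hn // => /eqP.
  - move=> v; apply/mapP; exists (index v (enum V)); last by rewrite /ev nth_index ?mem_enum.
    by rewrite mt -hn index_mem mem_enum.
  apply/(cycle_nthP _ v0) => k; rewrite size_map st => hk.
  have hk' : k.+1 %% n < n by rewrite ltn_mod (leq_trans _ V_ge3).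
  rewrite !(nth_map 0) ?st //.
  have ha : nth 0 t k < n by rewrite -mt mem_nth ?st.
  have hb : nth 0 t (k.+1 %% n) < n by rewrite -mt mem_nth ?st.
  (* Consecutive nodes must differ to form an edge; at the wrap-around this needs n > 1. *)
  have kk : k != k.+1 %% n.
    case: (ltnP k.+1 n) => hk1; first by rewrite modn_small // neq_ltn ltnSn.
    have -> : k.+1 = n by apply/eqP; rewrite eqn_leq hk hk1.
    by rewrite modnn; move: V_ge3; rewrite -/n; lia.
  have ab : nth 0 t k != nth 0 t (k.+1 %% n) by rewrite nth_uniq ?st.
  have [lt|lt|/eqP] := ltngtP (nth 0 t k) (nth 0 t (k.+1 %% n)); last by rewrite (negPf ab).
    apply: hs; first by rewrite lt.
    by apply/hasP; exists k; rewrite ?mem_iota //= !eqxx.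
  rewrite r_sym; apply: hs; first by rewrite lt.
  by apply/hasP; exists k; rewrite ?mem_iota //= !eqxx orbT.
have sp := ham_cycle_size hp; case: hp => up allp /(cycle_nthP _ v0).
rewrite sp -/n => cp.
pose t := [seq index v (enum V) | v <- p].
have nt k : k < n -> ev (nth 0 t k) = nth v0 p k.
  by move=> hk; rewrite (nth_map v0) ?sp // /ev nth_index ?mem_enum.
exists [seq cycle_edge n t e.1 e.2 | e <- edges n]; split.
- exists n, t; split=> //; split=> //; apply: uniq_perm; rewrite ?iota_uniq //.
    rewrite map_inj_in_uniq // => v w _ _ h.
    by rewrite -(nth_index v0 (mem_enum V v)) h nth_index ?mem_enum.
  move=> i; rewrite mem_iota /= add0n; apply/mapP/idP => [[v _ ->]|hi].
    by rewrite -hn index_mem mem_enum.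
  by exists (ev i) => //; rewrite /ev index_uniq ?enum_uniq ?hn.
- by rewrite size_map.
apply/avoids_cycle_edges => i j _ /hasP[k]; rewrite mem_iota /= => hk.
have hk' : k.+1 %% n < n by rewrite ltn_mod (leq_trans _ V_ge3).
have := cp k hk; rewrite -!nt // => h.
by case/orP=> /andP[/eqP <- /eqP <-] //; rewrite r_sym.
Qed.

End TSPHamilton.

(** * From directed to undirected Hamiltonian cycles *)

Section Undirected.
Variables (D : finType) (arc : rel D).

(* Every node of the directed graph becomes a path in - mid - out, encoded by
   [Some false], [None], [Some true]. *)
Definition half_edge (x y : D * option bool) : bool :=
  match x.2, y.2 with
  | Some false, None | None, Some true => x.1 == y.1
  | Some true, Some false => arc x.1 y.1
  | _, _ => false
  end.

Definition undirected : rel (D * option bool) := fun x y => half_edge x y || half_edge y x.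

Lemma undirected_sym : symmetric undirected.
Proof. by move=> x y; rewrite /undirected orbC. Qed.

Lemma undirected_ham_cycle p : p != [::] -> ham_cycle arc p ->
  exists q, ham_cycle undirected q.
Proof.
move=> p0 [up allp cp].
exists [seq (v, a) | v <- p, a <- [:: Some false; None; Some true]]; split.
- by apply: allpairs_uniq => // -[v a] [w b] _ _.
- move=> [v [[]|]]; apply/allpairsP.
  + by exists (v, Some true); rewrite !inE allp.
  + by exists (v, Some false); rewrite !inE allp.
  + by exists (v, None); rewrite !inE allp.
case: p p0 cp {up allp} => // x p _ /= cp.
have e1 v : undirected (v, Some false) (v, None) by rewrite /undirected /half_edge /= eqxx.
have e2 v : undirected (v, None) (v, Some true) by rewrite /undirected /half_edge /= eqxx.
have e3 v w : arc v w -> undirected (v, Some true) (w, Some false).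
  by rewrite /undirected /half_edge /= => ->.
rewrite e1 e2 /=.
have: forall y, path arc y (rcons p x) -> path undirected (y, Some true)
   (rcons (flatten [seq [:: (v, Some false); (v, None); (v, Some true)] | v <- p])
          (x, Some false)).
  elim: p {cp} => [|z p IH] y /=; first by rewrite !andbT; apply: e3.
  by move=> /andP[/e3-> /IH->]; rewrite e1 e2.
by apply.
Qed.

Section Orient.
Variable p : seq (D * option bool).
Hypotheses (hp : ham_cycle undirected p) (D_gt2 : 2 < #|D|).

(** The cycle visits everything, so there is a single orbit of [next]: an induction principle along
    the tour. *)
Lemma next_closed (S : pred (D * option bool)) w :
  S w -> (forall x, S x -> S (next p x)) -> forall y, S y.
Proof.
have [up allp cp] := hp; move=> Sw hS y.
have : fconnect (next p) w y by rewrite (fconnect_cycle (cycle_next up)).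
by move=> /iter_findex <-; elim: (findex _ _ _) => //= k; apply: hS.
Qed.

(** Otherwise [w] and its successor would exhaust the graph, which has 3|D| > 2 vertices. *)
Lemma next_neq_prev w : next p w != prev p w.
Proof.
have [up allp cp] := hp; apply/eqP => h.
have nn : next p (next p w) = w by rewrite h next_prev.
have S y : y \in [:: w; next p w].
  apply: (@next_closed [pred y | y \in [:: w; next p w]] w); first by rewrite inE mem_head.
  by move=> x; rewrite !inE => /orP[]/eqP->; rewrite ?nn eqxx ?orbT.
have : #|{: D * option bool}| <= size [:: w; next p w].
  by apply: leq_trans (card_size _); apply: subset_leq_card; apply/subsetP => y _; apply: S.
by rewrite card_prod card_option card_bool /=; move: D_gt2; case: #|D| => [|[|[|k]]].
Qed.

Let mid v : D * option bool := (v, None).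
Let inn v : D * option bool := (v, Some false).
Let out v : D * option bool := (v, Some true).

Lemma undirected_mid v y : undirected (mid v) y -> y = inn v \/ y = out v.
Proof.
case: y => w [[]|]; rewrite /undirected /half_edge /= ?orbF //.
  by move=> /eqP->; right.
by move=> /eqP->; left.
Qed.

Lemma undirected_out v y : undirected (out v) y -> y = mid v \/ exists2 u, y = inn u & arc v u.
Proof.
case: y => w [[]|]; rewrite /undirected /half_edge /= ?orbF //.
  by move=> h; right; exists w.
by move=> /eqP->; left.
Qed.

(** A middle vertex left towards its out-vertex forces the node visited next to be traversed the
    same way, so the whole tour is oriented. Instead of a directed Hamiltonian cycle, only what
    [successor_sat] uses is extracted: a permutation along arcs without 2-cycles. *)
Lemma oriented_successor : (exists v, next p (mid v) = out v) ->
  exists s : D -> D, [/\ injective s, forall v, arc v (s v) & forall v, s (s v) != v].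
Proof.
have [up allp cp] := hp; move=> [v0 or0].
pose ori v := next p (mid v) == out v.
have in_mid v : ori v -> next p (inn v) = mid v.
  move=> /eqP o; have /undirected_mid[h|h] : undirected (mid v) (prev p (mid v)).
  - by rewrite undirected_sym; apply: prev_cycle.
  - by rewrite -h next_prev.
  - by have := next_neq_prev (mid v); rewrite h o eqxx.
have out_in v : ori v -> exists u, [/\ next p (out v) = inn u, arc v u & ori u].
  move=> /eqP o; have /undirected_out[h|[u h a]] : undirected (out v) (next p (out v)).
  - exact: next_cycle.
  - by have := next_neq_prev (out v); rewrite h -o prev_next // eqxx.
  exists u; split=> //.
  have /undirected_mid[h'|/eqP//] : undirected (mid u) (next p (mid u)) by apply: next_cycle.
  have : prev p (inn u) = mid u by rewrite -h' prev_next.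
  by rewrite -h prev_next.
have all_ori v : ori v.
  apply: (@next_closed [pred w | ori w.1] (mid v0) _ _ (mid v)); first exact/eqP.
  move=> [w [[]|]] /= o.
  - by have [u [-> _ ou]] := out_in w o.
  - by rewrite in_mid.
  - by rewrite (eqP o).
have hs v : next p (out v) = inn (next p (out v)).1 /\ arc v (next p (out v)).1.
  by have [u [-> a _]] := out_in v (all_ori v).
exists (fun v => (next p (out v)).1); split.
- move=> v w h; have : next p (out v) = next p (out w) by rewrite (hs v).1 (hs w).1 h.
  by move=> /(can_inj (prev_next up))[].
- by move=> v; apply: (hs v).2.
move=> v; apply/eqP; set u := (next p (out v)).1 => uv.
have S w : w \in [:: v; u].
  apply: (@next_closed [pred y | y.1 \in [:: v; u]] (mid v) _ _ (mid w)); first exact: mem_head.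
  move=> [y a] hy; have {}hy : y \in [:: v; u] by [].
  case: a => [[]|]; rewrite inE.
  - by rewrite (hs y).1 /=; move: hy; rewrite !inE => /orP[]/eqP->; rewrite ?uv -/u eqxx ?orbT.
  - by rewrite -/(inn y) in_mid.
  - by rewrite (eqP (all_ori y)).
have : #|D| <= size [:: v; u].
  by apply: leq_trans (card_size _); apply: subset_leq_card; apply/subsetP => y _; apply: S.
by rewrite /= leqNgt D_gt2.
Qed.

End Orient.

(** A cycle that runs the wrong way through some node is reversed. *)
Lemma ham_cycle_successor p : ham_cycle undirected p -> 2 < #|D| ->
  exists s : D -> D, [/\ injective s, forall v, arc v (s v) & forall v, s (s v) != v].
Proof.
move=> hp D2; have [up allp cp] := hp.
have hr : ham_cycle undirected (rev p).
  split; [by rewrite rev_uniq|by move=> v; rewrite mem_rev|].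
  by rewrite rev_cycle (eq_cycle (e' := undirected)) // => x y; apply: undirected_sym.
have [v0 _] : exists v : D, true by case/card_gt0P: (ltnW (ltnW D2)) => v _; exists v.
have := next_cycle cp (allp (v0, None)) => /undirected_mid[h|h]; last first.
  by apply: (oriented_successor hp) => //; exists v0.
apply: (oriented_successor hr) => //; exists v0.
rewrite next_rev //.
have := prev_cycle cp (allp (v0, None)); rewrite undirected_sym => /undirected_mid[h'|//].
by have := next_neq_prev hp D2 (v0, None); rewrite h h' eqxx.
Qed.

End Undirected.

(** * From satisfiability to directed Hamiltonian cycles *)

Section SatGraph.
Variables (X CL : finType) (lit : CL -> X -> bool -> bool).
Let M := #|CL|.
Let top := 3 * M + 2.

(* The chain of variable [i] has positions [0 .. 3M+2]; clause number [c] can be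
   visited as a detour between positions [3c+2] and [3c+3], in the direction
   given by the sign of its literal on [i].  A cycle runs through the chain
   upwards if [i] is true and downwards if it is false. *)
Definition sat_node : finType := (X * 'I_top.+1 + CL)%type.
Definition chain i k : sat_node := inl (i, inord k).
Definition chain_end k := (k == 0) || (k == top).

(** Chain ends are pairwise joined, so chains may follow each other in any order and direction.
    Positions 3c+1 carry no clause arcs and act as separators. *)
Definition sat_arc : rel sat_node := fun v w =>
  match v, w with
  | inl (i, k), inl (i', k') =>
      (i == i') && ((k.+1 == k' :> nat) || (k'.+1 == k :> nat)) || chain_end k && chain_end k'
  | inl (i, k), inr c => lit c i true && (k == 3 * enum_rank c + 2 :> nat)
                      || lit c i false && (k == 3 * enum_rank c + 3 :> nat)
  | inr c, inl (i, k) => lit c i true && (k == 3 * enum_rank c + 3 :> nat)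
                      || lit c i false && (k == 3 * enum_rank c + 2 :> nat)
  | inr _, inr _ => false
  end.

Lemma chain_inj i i' k k' : k <= top -> k' <= top -> chain i k = chain i' k' -> i = i' /\ k = k'.
Proof. by move=> hk hk' [-> /(congr1 val)]; rewrite /= !inordK. Qed.

Lemma sat_arc_out i k w : k <= top -> ~~ chain_end k -> sat_arc (chain i k) w ->
  [\/ k < top /\ w = chain i k.+1, w = chain i k.-1 |
      exists2 c, w = inr c & lit c i true && (k == 3 * enum_rank c + 2)
                      || lit c i false && (k == 3 * enum_rank c + 3)].
Proof.
move=> hk ne; case: w => [[i' k']|c] /=; rewrite inordK //; last first.
  by move=> h; apply: Or33; exists c.
rewrite (negPf ne) orbF => /andP[/eqP<- /orP[/eqP e|/eqP e]].
  have := ltn_ord k'; rewrite -e ltnS => h; apply: Or31; split=> //.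
  by rewrite /chain e inord_val.
by apply: Or32; rewrite /chain -e /= inord_val.
Qed.

Lemma sat_arc_in i k w : k <= top -> ~~ chain_end k -> sat_arc w (chain i k) ->
  [\/ k < top /\ w = chain i k.+1, w = chain i k.-1 |
      exists2 c, w = inr c & lit c i true && (k == 3 * enum_rank c + 3)
                      || lit c i false && (k == 3 * enum_rank c + 2)].
Proof.
move=> hk ne; case: w => [[i' k']|c] /=; rewrite inordK //; last first.
  by move=> h; apply: Or33; exists c.
rewrite (negPf ne) andbF orbF => /andP[/eqP-> /orP[/eqP e|/eqP e]].
  by apply: Or32; rewrite /chain -e /= inord_val.
have := ltn_ord k'; rewrite -e ltnS => h; apply: Or31; split=> //.
by rewrite /chain e inord_val.
Qed.

(** Both neighbours of a separator lie on its chain and 2-cycles are excluded, so [s] passes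
    straight through it, up or down. The direction cannot change from one separator to the next
    ([upS]): positions 3c+2 and 3c+3 would both have clause [c] as successor, or both as
    predecessor. The chain node before a clause thus has a literal that agrees with the
    direction. *)
Lemma successor_sat (s : sat_node -> sat_node) :
  injective s -> (forall v, sat_arc v (s v)) -> (forall v, s (s v) != v) ->
  exists alpha : X -> bool, forall c, exists i, lit c i (alpha i).
Proof.
move=> sinj sarc s2.
have spre w : exists v, s v = w.
  by exists (invF sinj w); rewrite f_invF.
have nend0 k : 0 < k -> k < top -> ~~ chain_end k.
  by rewrite /chain_end negb_or => h1 h2; apply/andP; split; lia.
have sep i c : c <= M ->
    (s (chain i (3 * c + 1)) = chain i (3 * c + 2) /\ s (chain i (3 * c)) = chain i (3 * c + 1))
 \/ (s (chain i (3 * c + 1)) = chain i (3 * c) /\ s (chain i (3 * c + 2)) = chain i (3 * c + 1)).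
  move=> hc; have hk : 3 * c + 1 < top by rewrite /top; lia.
  have ne : ~~ chain_end (3 * c + 1) by apply: nend0 => //; lia.
  have e1 : (3 * c + 1).+1 = 3 * c + 2 by lia.
  have e2 : (3 * c + 1).-1 = 3 * c by lia.
  have [w hw] := spre (chain i (3 * c + 1)).
  have := sarc w; rewrite hw => /(sat_arc_in (ltnW hk) ne); rewrite e1 e2.
  have := sarc (chain i (3 * c + 1)) => /(sat_arc_out (ltnW hk) ne); rewrite e1 e2.
  case=> [[_ so]|so|[c' _ h]]; last by exfalso; lia.
  - case=> [[_ wi]|wi|[c' _ h]]; last by exfalso; lia.
    + by have := s2 (chain i (3 * c + 1)); rewrite so -wi hw eqxx.
    + by left; rewrite so -{1}wi hw.
  - case=> [[_ wi]|wi|[c' _ h]]; last by exfalso; lia.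
    + by right; rewrite so -{1}wi hw.
    + by have := s2 (chain i (3 * c + 1)); rewrite so -wi hw eqxx.
pose up i c := s (chain i (3 * c + 1)) == chain i (3 * c + 2).
have chainN i k k' : k <= top -> k' <= top -> k != k' -> chain i k = chain i k' -> False.
  by move=> hk hk' /eqP ne h; apply: ne; have [] := chain_inj hk hk' h.
have sneq i k k' l : k <= top -> k' <= top -> k != k' ->
    s (chain i k) = l -> s (chain i k') = l -> False.
  by move=> hk hk' ne h1 h2; apply: (chainN i _ _ hk hk' ne (sinj _ _ (etrans h1 (esym h2)))).
have sepT i c : c <= M -> up i c ->
    s (chain i (3 * c + 1)) = chain i (3 * c + 2) /\ s (chain i (3 * c)) = chain i (3 * c + 1).
  move=> hc /eqP u; have [//|[d _]] := sep i c hc; exfalso.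
  by apply: (chainN i (3 * c + 2) (3 * c)); rewrite -?u -?d // /top; lia.
have sepF i c : c <= M -> ~~ up i c ->
    s (chain i (3 * c + 1)) = chain i (3 * c) /\ s (chain i (3 * c + 2)) = chain i (3 * c + 1).
  by move=> hc /eqP u; have [[d _]|//] := sep i c hc.
have upS i c : c < M -> up i c = up i c.+1.
  move=> hc; have c3 : 3 * c.+1 = 3 * c + 3 by lia.
  have htop : 3 * c + 5 <= top by rewrite /top; lia.
  have ne2 : ~~ chain_end (3 * c + 2) by apply: nend0; lia.
  have ne3 : ~~ chain_end (3 * c + 3) by apply: nend0; lia.
  have k2 : 3 * c + 2 <= top by lia.
  have k3 : 3 * c + 3 <= top by lia.
  have f4 : 3 * c + 3 + 1 = 3 * c + 4 by lia.
  have f5 : 3 * c + 3 + 2 = 3 * c + 5 by lia.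
  have e3 : (3 * c + 2).+1 = 3 * c + 3 by lia.
  have e1 : (3 * c + 2).-1 = 3 * c + 1 by lia.
  have e4 : (3 * c + 3).+1 = 3 * c + 4 by lia.
  have e2 : (3 * c + 3).-1 = 3 * c + 2 by lia.
  have clause_eq (d d' : CL) : c = enum_rank d -> c = enum_rank d' -> d = d'.
    by move=> h h'; apply: enum_rank_inj; apply: val_inj; rewrite /= -h -h'.
  have [u|u] := boolP (up i c); have [v|v] := boolP (up i c.+1) => //; exfalso.
    have [s1 s0] := sepT i c (ltnW hc) u.
    have := sepF i c.+1 hc v; rewrite c3 f4 f5 => -[s4 s5].
    have := sat_arc_out k3 ne3 (sarc (chain i (3 * c + 3))).
    rewrite e4 e2 => -[[_ h]|h|[d hd h]].
    - by apply: (sneq i _ _ _ _ _ _ s5 h); lia.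
    - by apply: (sneq i _ _ _ _ _ _ s1 h); lia.
    have := sat_arc_out k2 ne2 (sarc (chain i (3 * c + 2))).
    rewrite e3 e1 => -[[_ h']|h'|[d' hd' h']].
    - by apply: (sneq i _ _ _ _ _ _ s4 h'); lia.
    - by apply: (sneq i _ _ _ _ _ _ s0 h'); lia.
    have dd : d' = d by apply: clause_eq; lia.
    by rewrite dd in hd'; apply: (sneq i _ _ _ _ _ _ hd' hd); lia.
  have [s1 s0] := sepF i c (ltnW hc) u.
  have := sepT i c.+1 hc v; rewrite c3 f4 f5 => -[s4 s3].
  have [w hw] := spre (chain i (3 * c + 2)); have [w' hw'] := spre (chain i (3 * c + 3)).
  have := sarc w; rewrite hw => /(sat_arc_in k2 ne2); rewrite e3 e1 => -[[_ h]|h|[d hd h]].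
  - by rewrite h s3 in hw; apply: (chainN i _ _ _ _ _ hw); lia.
  - by rewrite h s1 in hw; apply: (chainN i _ _ _ _ _ hw); lia.
  have := sarc w'; rewrite hw' => /(sat_arc_in k3 ne3); rewrite e4 e2 => -[[_ h']|h'|[d' hd' h']].
  - by rewrite h' s4 in hw'; apply: (chainN i _ _ _ _ _ hw'); lia.
  - by rewrite h' s0 in hw'; apply: (chainN i _ _ _ _ _ hw'); lia.
  have dd : d' = d by apply: clause_eq; lia.
  by rewrite hd' dd -hd hw in hw'; apply: (chainN i _ _ _ _ _ hw'); lia.
have up0 i c : c <= M -> up i c = up i 0.
  by elim: c => // c IH hc; rewrite -upS // IH // ltnW.
exists (fun i => up i 0) => c.
have rM : enum_rank c < M by apply: ltn_ord.
have [w hw] := spre (inr c); have := sarc w; rewrite hw.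
case: w hw => [[i k]|//] hw /orP[] /andP[hl /eqP hk]; exists i.
  have hw' : s (chain i (3 * enum_rank c + 2)) = inr c by rewrite -hk /chain inord_val.
  have [u|u] := boolP (up i (enum_rank c)); first by rewrite -(up0 i _ (ltnW rM)) u.
  by have [_] := sepF i _ (ltnW rM) u; rewrite hw'.
have hw' : s (chain i (3 * (enum_rank c).+1)) = inr c.
  by rewrite mulnS addnC -hk /chain inord_val.
have [u|u] := boolP (up i (enum_rank c).+1).
  by have [_] := sepT i _ rM u; rewrite hw'.
by rewrite -(up0 i _ rM) (negPf u).
Qed.

(** * A Hamiltonian cycle from a satisfying assignment *)

Section Tour.
Variables (alpha : X -> bool) (ch : CL -> X).
Hypothesis hch : forall c, lit c (ch c) (alpha (ch c)).

Definition detour i k : seq sat_node :=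
  if [pick c | (3 * enum_rank c + 2 == k) && (ch c == i)] is Some c then [:: inr c] else [::].

Definition chain_tour i n := flatten [seq rcons (detour i j) (chain i j.+1) | j <- iota 0 n].

(** Strictly increasing along a chain with its detours, which gives [block_uniq]; the odd value puts
    a clause between positions 3c+2 and 3c+3. *)
Definition height (v : sat_node) : nat :=
  match v with inl (_, k) => 2 * k | inr c => 2 * (3 * enum_rank c + 2) + 1 end.

(** The chain of a false variable is also built upwards, along reversed arcs; [block] then reverses
    the list. *)
Definition oriented_arc i : rel sat_node :=
  if alpha i then sat_arc else fun x y => sat_arc y x.

Lemma chain_tourS i n :
  chain_tour i n.+1 = chain_tour i n ++ rcons (detour i n) (chain i n.+1).
Proof. by rewrite /chain_tour -[in LHS]addn1 iotaD map_cat flatten_cat /= cats0. Qed.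

Lemma height_chain i k : k <= top -> height (chain i k) = 2 * k.
Proof. by move=> hk; rewrite /= inordK. Qed.

Lemma oriented_arc_chain i k : k < top -> oriented_arc i (chain i k) (chain i k.+1).
Proof.
move=> hk; rewrite /oriented_arc.
by case: (alpha i); rewrite /= !inordK ?ltnS ?(ltnW hk) // !eqxx ?orbT.
Qed.

Lemma clause_top (c : CL) : 3 * enum_rank c + 3 <= top.
Proof. by have : enum_rank c < M by []; rewrite /top; lia. Qed.

Lemma oriented_arc_enter (c : CL) :
  oriented_arc (ch c) (chain (ch c) (3 * enum_rank c + 2)) (inr c).
Proof.
have := hch c; have := clause_top c; rewrite /oriented_arc => ht.
have hk : 3 * enum_rank c + 2 < top.+1 by apply: leq_ltn_trans _ (ltnSn top); lia.
by case: (alpha _) => h; rewrite /= inordK // h eqxx ?orbT.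
Qed.

Lemma oriented_arc_leave (c : CL) :
  oriented_arc (ch c) (inr c) (chain (ch c) (3 * enum_rank c + 2).+1).
Proof.
have := hch c; have := clause_top c; rewrite /oriented_arc -addnS => ht.
by case: (alpha _) => h; rewrite /= inordK // h eqxx ?orbT.
Qed.

Lemma chain_tour_path i n : n <= top ->
  path (fun x y => oriented_arc i x y && (height x < height y)) (chain i 0) (chain_tour i n)
  /\ last (chain i 0) (chain_tour i n) = chain i n.
Proof.
elim: n => // n IH hn; have [IH1 IH2] := IH (ltnW hn).
rewrite chain_tourS cat_path last_cat IH1 IH2 last_rcons; split=> //.
have path2 (e : rel sat_node) x y z : path e x [:: y; z] = e x y && e y z by rewrite /= andbT.
have path1 (e : rel sat_node) x y : path e x [:: y] = e x y by rewrite /= andbT.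
rewrite /detour; case: pickP => [c /andP[/eqP hc /eqP hi]|_].
  rewrite path2 -hi -hc oriented_arc_enter oriented_arc_leave !height_chain ?hc ?(ltnW hn) //.
  by rewrite /height -hc; lia.
by rewrite path1 oriented_arc_chain // !height_chain ?(ltnW hn) //; lia.
Qed.

Definition block i : seq sat_node :=
  let q := chain i 0 :: chain_tour i top in if alpha i then q else rev q.

Definition is_end (v : sat_node) : bool := if v is inl (_, k) then chain_end k else false.

Lemma is_end_arc v w : is_end v -> is_end w -> sat_arc v w.
Proof. by case: v w => [[i k]|//] [[i' k']|//] /= -> ->; rewrite orbT. Qed.

Lemma block_path i : exists y q, [/\ block i = y :: q, path sat_arc y q, is_end y & is_end (last y q)].
Proof.
have [hp hl] := chain_tour_path i (leqnn top).
have {}hp : path (oriented_arc i) (chain i 0) (chain_tour i top).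
  by apply: sub_path hp => x y /andP[].
have e0 : is_end (chain i 0) by rewrite /= inordK.
have e1 : is_end (chain i top) by rewrite /= inordK // /chain_end eqxx orbT.
rewrite /block; move: hp; rewrite /oriented_arc; case: (alpha i) => hp.
  by exists (chain i 0), (chain_tour i top); rewrite hl.
rewrite lastI rev_rcons hl.
exists (chain i top), (rev (belast (chain i 0) (chain_tour i top))); split=> //.
  by rewrite -hl rev_path.
have := congr1 (last (chain i 0)) (rev_cons (chain i 0) (chain_tour i top)).
by rewrite last_rcons lastI rev_rcons hl /= => ->.
Qed.

Lemma blocks_path z (l : seq X) : is_end z ->
  path sat_arc z (flatten (map block l)) /\ is_end (last z (flatten (map block l))).
Proof.
elim: l z => [|i l IH] z hz //=.
have [y [q [-> pq ey eq]]] := block_path i.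
rewrite cat_path last_cat /= is_end_arc // pq /=; exact: IH.
Qed.

Definition owner (v : sat_node) : X := match v with inl (i, _) => i | inr c => ch c end.

Lemma mem_block i v : v \in block i -> owner v = i.
Proof.
have -> : (v \in block i) = (v \in chain i 0 :: chain_tour i top).
  by rewrite /block; case: ifP => // _; rewrite mem_rev.
rewrite inE => /orP[/eqP->//|/flattenP[q /mapP[j _ ->]]].
rewrite mem_rcons inE => /orP[/eqP->//|].
rewrite /detour; case: pickP => [c /andP[_ /eqP <-]|//].
by rewrite inE => /eqP->.
Qed.

Lemma block_mem v : v \in block (owner v).
Proof.
have -> : (v \in block (owner v)) = (v \in chain (owner v) 0 :: chain_tour (owner v) top).
  by rewrite /block; case: ifP => // _; rewrite mem_rev.
case: v => [[i k]|c] /=; rewrite inE.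
  have [k0|k0] := eqVneq (k : nat) 0.
    by apply/orP; left; rewrite /chain -k0 inord_val.
  apply/orP; right; apply/flattenP; exists (rcons (detour i k.-1) (chain i k.-1.+1)).
    by apply/mapP; exists k.-1; rewrite // mem_iota; have := ltn_ord k; lia.
  by rewrite mem_rcons inE prednK ?lt0n // /chain inord_val eqxx.
apply/orP; right; apply/flattenP.
exists (rcons (detour (ch c) (3 * enum_rank c + 2)) (chain (ch c) (3 * enum_rank c + 2).+1)).
  apply/mapP; exists (3 * enum_rank c + 2); rewrite // mem_iota /top.
  by have : enum_rank c < M by []; lia.
rewrite mem_rcons inE /detour; case: pickP => [c' /andP[/eqP h _]|/(_ c)]; last by rewrite !eqxx.
rewrite inE; apply/orP; right; apply/eqP; congr inr.
apply: enum_rank_inj; apply: val_inj.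
by move/addIn: h => /eqP; rewrite eqn_mul2l /= => /eqP.
Qed.

Lemma block_uniq i : uniq (block i).
Proof.
have : uniq (chain i 0 :: chain_tour i top).
  have [hp _] := chain_tour_path i (leqnn top).
  apply: (@sorted_uniq _ (fun x y => height x < height y)).
  - by move=> y x z; apply: ltn_trans.
  - by move=> x; rewrite ltnn.
  by apply: sub_path hp => x y /andP[].
by rewrite /block; case: ifP => // _; rewrite rev_uniq.
Qed.

Lemma sat_ham_cycle (i0 : X) : exists p, ham_cycle sat_arc p.
Proof.
exists (flatten (map block (enum X))); split.
- have := enum_uniq X; elim: (enum X) => //= i l IH /andP[il ul].
  rewrite cat_uniq block_uniq IH // andbT; apply/hasPn => v /flattenP[q /mapP[j jl ->]] vj.
  apply/negP => /mem_block oi; move: il; rewrite -oi (mem_block vj) => /negP; exact.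
- move=> v; apply/flattenP; exists (block (owner v)); last exact: block_mem.
  by apply: map_f; rewrite mem_enum.
have : enum X != [::] by apply/eqP => h; have := mem_enum X i0; rewrite h.
case: (enum X) => //= i l _.
have [y [q [bi _ ey _]]] := block_path i.
have := blocks_path (i :: l) ey; rewrite /= bi /= rcons_path => -[/andP[_ ->] hl] /=.
exact: is_end_arc.
Qed.

End Tour.

End SatGraph.

(** * From Turing machines to satisfiability *)

Section CookLevin.
Variables (Mc : TM) (m P W : nat).
Let Q := tm_Q Mc.
Let G := tm_G Mc.
Let S := P + m + W + 2.

Definition var : finType :=
  ('I_m + 'I_P.+1 * 'I_S.+1 + 'I_P.+1 * 'I_Q.+1 + 'I_P.+1 * 'I_S.+1 * 'I_G.+4)%type.

Definition vinput (i : 'I_m) : var := inl (inl (inl i)).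
Definition vhead (t j : nat) : var := inl (inl (inr (inord t, inord j))).
Definition vstate (t : nat) (q : 'I_Q.+1) : var := inl (inr (inord t, q)).
Definition vcell (t j : nat) (a : 'I_G.+4) : var := inr (inord t, inord j, a).

(** In order: input bits, initial tape, initial head and state, transitions (the option picks head,
    state or written cell), unchanged cells, acceptance. The type does not depend on the input;
    indices with nothing to state get a tautology in [literals]. *)
Definition clause : finType :=
  ('I_m + 'I_S.+1 * bool + bool + 'I_P * 'I_S.+1 * 'I_Q.+1 * 'I_G.+4 * option bool
   + 'I_P * 'I_S.+1 * 'I_S.+1 * 'I_G.+4 + 'I_S.+1 * 'I_Q.+1 * 'I_G.+4)%type.

(** A halted machine stays put, so acceptance within [P] steps becomes acceptance at time [P]. *)
Definition next_local (q : 'I_Q.+1) (a : 'I_G.+4) (h : nat) : 'I_Q.+1 * 'I_G.+4 * nat :=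
  match tm_delta q a with
  | None => (q, a, h)
  | Some (q', a', d) => (q', a', match d with MoveL => h.-1 | MoveR => h.+1 | MoveS => h end)
  end.

Definition local_accepting (q : 'I_Q.+1) (a : 'I_G.+4) : bool :=
  (if tm_delta q a is None then true else false) && tm_acc q.

(* Only forward implications are imposed: a satisfying assignment may make
   further variables true, but it makes those describing the run true. *)
Definition literals (x : seq bool) (c : clause) : seq (var * bool) :=
  match c with
  | inl (inl (inl (inl (inl i)))) => [:: (vinput i, nth false x i)]
  | inl (inl (inl (inl (inr (j, b))))) =>
      if insub (val j) is Some i then
        [:: (vinput i, ~~ b); (vcell 0 j (inord (if b then 2 else 1)), true)]
      else if j == m :> nat then [:: (vcell 0 j (inord 3), true)]
      else if j <= m + W then
        if b then [:: (vcell 0 j (inord 0), true); (vcell 0 j (inord 1), true);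
                      (vcell 0 j (inord 2), true)]
        else [:: (vcell 0 j (inord 0), false); (vcell 0 j.+1 (inord 0), true)]
      else [:: (vcell 0 j (inord 0), true)]
  | inl (inl (inl (inr b))) => [:: (if b then vhead 0 0 else vstate 0 ord0, true)]
  | inl (inl (inr (t, h, q, a, k))) =>
      let: (q', a', h') := next_local q a h in
      [:: (vhead t h, false); (vstate t q, false); (vcell t h a, false);
          (match k with None => vhead t.+1 h' | Some false => vstate t.+1 q'
                      | Some true => vcell t.+1 h a' end, true)]
  | inl (inr (t, h, j, a)) =>
      if h == j then [:: (vhead t h, false); (vhead t h, true)]
      else [:: (vhead t h, false); (vcell t j a, false); (vcell t.+1 j a, true)]
  | inr (h, q, a) =>
      if local_accepting q a then [:: (vhead P h, false); (vhead P h, true)]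
      else [:: (vhead P h, false); (vstate P q, false); (vcell P h a, false)]
  end.

Definition lit x c i b := (i, b) \in literals x c.

Definition satisfies (alpha : var -> bool) x c := has (fun p => alpha p.1 == p.2) (literals x c).

Lemma satisfiesP alpha x c : satisfies alpha x c <-> exists i, lit x c i (alpha i).
Proof.
split=> [/hasP[[i b] /= h /eqP e]|[i h]]; first by exists i; rewrite e.
by apply/hasP; exists (i, alpha i) => /=.
Qed.

Definition input_of (c : clause) : nat :=
  if c is inl (inl (inl (inl (inl i)))) then i else 0.

(** Only input clauses mention [x], each through one bit, so [x] may be replaced by the constant
    word of that bit. This makes the reduction a projection. *)
Lemma literals_input x c : literals x c = literals (nseq m (nth false x (input_of c))) c.
Proof.
by case: c => [[[[[i|[j b]]|b]|[[[[t h] q] a] k]]|[[[t h] j] a]]|[[h q] a]] //=;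
  rewrite nth_nseq ltn_ord.
Qed.

Definition tape_word (x w : seq bool) := enc_bits x ++ 3 :: enc_bits w.

Lemma nth_tape_word x w j : size x = m ->
  nth 0 (tape_word x w) j =
    if j < m then (if nth false x j then 2 else 1)
    else if j == m then 3
    else if j - m.+1 < size w then (if nth false w (j - m.+1) then 2 else 1) else 0.
Proof.
move=> hx; rewrite nth_cat size_map hx; case: ltnP => hj.
  by rewrite (nth_map false) ?hx.
have [->|ne] := eqVneq j m; first by rewrite subnn.
have -> : j - m = (j - m.+1).+1 by lia.
rewrite /=; case: ltnP => hw; first by rewrite (nth_map false).
by rewrite nth_default ?size_map.
Qed.

Section Run.
Variables x w : seq bool.

Definition run t := iter t (@tm_step Mc) (tm_init Mc (tape_word x w)).
Definition run_state t : 'I_Q.+1 := (run t).1.1.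
Definition run_tape t : nat -> 'I_G.+4 := (run t).1.2.
Definition run_head t : nat := (run t).2.

Lemma run_step t : let n := next_local (run_state t) (run_tape t (run_head t)) (run_head t) in
  [/\ run_state t.+1 = n.1.1, run_head t.+1 = n.2 &
   forall j, run_tape t.+1 j = if j == run_head t then n.1.2 else run_tape t j].
Proof.
rewrite /run_state /run_tape /run_head /run iterS -/(run t) /next_local.
case: (run t) => [[q tape] h] /=; case: tm_delta => [[[q' a'] d]|] //=.
by split=> // j; case: eqP => [->|].
Qed.

Lemma run_head_le t : run_head t <= t.
Proof.
elim: t => // t IH; have [_ -> _] := run_step t; rewrite /next_local.
by case: tm_delta => [[[q' a'] []]|] /=; lia.
Qed.

Lemma run_tape0 j : run_tape 0 j = inord (nth 0 (tape_word x w) j).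
Proof. by []. Qed.

Lemma run_accepting t :
  tm_accepting (run t) = local_accepting (run_state t) (run_tape t (run_head t)).
Proof.
rewrite /tm_accepting /local_accepting /run_state /run_tape /run_head.
by case: (run t) => [[q tape] h] /=; case: tm_delta.
Qed.

Lemma run_halt k : k <= P -> tm_accepting (run k) -> run P = run k.
Proof.
move=> hk acc.
have fix_step (c : config Mc) : tm_accepting c -> tm_step c = c.
  by case: c => [[q tape] h]; rewrite /tm_accepting /tm_halted /=; case: tm_delta.
have -> : P = (P - k) + k by lia.
rewrite /run iterD -/(run k); elim: (P - k) => // d IH.
by rewrite iterS IH fix_step.
Qed.

End Run.

(** The witness is read off the cells behind the separator, up to the first blank. Cells may carry
    several symbols; once the witness is fixed, the forward implications make the variables of its
    run true. *)
Lemma satisfiable_accepts x alpha : size x = m -> (forall c, satisfies alpha x c) ->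
  exists2 w, size w <= W & accepts_within Mc (tape_word x w) P.
Proof.
move=> hx ha.
pose z k := alpha (vcell 0 (m.+1 + k) (inord 0)).
(* If none of these cells is blank, [find] returns [W], where a unit clause forces a blank. *)
pose len := find z (iota 0 W).
have lenW : len <= W by rewrite -[W](size_iota 0) find_size.
pose w := [seq alpha (vcell 0 (m.+1 + k) (inord 2)) | k <- iota 0 len].
have sw : size w = len by rewrite size_map size_iota.
have hinput (i : 'I_m) : alpha (vinput i) = nth false x i.
  by have := ha (inl (inl (inl (inl (inl i))))); rewrite /satisfies /= orbF => /eqP.
have hB (j : nat) b : satisfies alpha x (inl (inl (inl (inl (inr (inord j, b)))))).
  exact: ha.
have unit_zero k : W <= k -> m.+1 + k <= S -> z k.
  move=> kW hS; have := hB (m.+1 + k) true.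
  rewrite /satisfies /= inordK // insubF; last by lia.
  rewrite ifF; last by lia.
  rewrite ifF; last by lia.
  by rewrite /= orbF => /eqP.
have len_zero : m.+1 + len <= S -> z len.
  move=> hS; have [lt|/unit_zero] := ltnP len W; last exact.
  have : has z (iota 0 W) by rewrite has_find size_iota.
  by move=> /(nth_find 0); rewrite -/len nth_iota.
have zeros k : len <= k -> m.+1 + k <= S -> z k.
  elim: k => [|k IH]; first by rewrite leqn0 => /eqP <-; apply: len_zero.
  rewrite leq_eqVlt => /orP[/eqP <-|hk] hS; first exact: len_zero.
  have [kW|/unit_zero] := ltnP k.+1 W; last exact.
  have zk : z k by apply: IH => //; lia.
  have := hB (m.+1 + k) false.
  rewrite /satisfies /= inordK; last by lia.
  rewrite insubF; last by lia.
  rewrite ifF; last by lia.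
  rewrite ifT; last by lia.
  by rewrite /= -/(z k) zk -addnS orbF /= => /eqP.
have tape0 j : j <= S -> alpha (vcell 0 j (run_tape x w 0 j)).
  move=> jS; rewrite run_tape0 nth_tape_word //.
  case: ltnP => hj.
    have := hB j (nth false x j).
    rewrite /satisfies /= inordK // insubT /= hinput /=.
    by case: nth => /=; rewrite ?orbF => /eqP.
  have [ej|nj] := eqVneq j m.
    have := hB j true; rewrite /satisfies /= inordK // insubF; last by lia.
    by rewrite ej eqxx /= orbF => /eqP.
  have ek : j = m.+1 + (j - m.+1) by lia.
  move: (j - m.+1) ek => k ek; subst j; rewrite sw.
  case: ltnP => hk; last exact: zeros.
  rewrite (nth_map 0) ?size_iota // nth_iota //= add0n.
  have nz : z k = false.
    by have := before_find 0 hk; rewrite nth_iota //; apply: leq_trans hk lenW.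
  have := hB (m.+1 + k) true; rewrite /satisfies /= inordK //.
  rewrite insubF; last by lia.
  rewrite ifF; last by lia.
  rewrite ifT; last by lia.
  (* The cell is not blank, so where symbol 2 fails the clause leaves symbol 1. *)
  rewrite /= -/(z k) nz /= orbF !eqb_id.
  by case E: (alpha (vcell 0 (m.+1 + k) (inord 2))) => /=; rewrite ?E ?orbF.
have hD t h q a k : t < P -> h <= S -> alpha (vhead t h) -> alpha (vstate t q) ->
    alpha (vcell t h a) -> let n := next_local q a h in
    alpha (match k with None => vhead t.+1 n.2 | Some false => vstate t.+1 n.1.1
                      | Some true => vcell t.+1 h n.1.2 end).
  move=> tP hS h1 h2 h3.
  have := ha (inl (inl (inr (Ordinal tP, inord h, q, a, k)))).
  rewrite /satisfies /= inordK //; case: next_local => [[q' a'] h'] /=.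
  by rewrite h1 h2 h3 /= orbF => /eqP.
have hE t h j a : t < P -> h <= S -> j <= S -> h != j -> alpha (vhead t h) ->
    alpha (vcell t j a) -> alpha (vcell t.+1 j a).
  move=> tP hS jS hj h1 h2.
  have := ha (inl (inr (Ordinal tP, inord h, inord j, a))).
  rewrite /satisfies /= ifF; last by apply/negbTE; rewrite -val_eqE /= !inordK.
  by rewrite /= !inordK // h1 h2 /= orbF => /eqP.
have hrun t : t <= P -> [/\ alpha (vhead t (run_head x w t)), alpha (vstate t (run_state x w t))
    & forall j, j <= S -> alpha (vcell t j (run_tape x w t j))].
  elim: t => [_|t IH tP].
    split=> //.
      by have := ha (inl (inl (inl (inr true)))); rewrite /satisfies /= orbF => /eqP.
    by have := ha (inl (inl (inl (inr false)))); rewrite /satisfies /= orbF => /eqP.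
  have [h1 h2 h3] := IH (ltnW tP); have [-> -> tp] := run_step x w t.
  have hS : run_head x w t <= S by have := run_head_le x w t; rewrite /S; lia.
  have step k := hD t _ _ _ k tP hS h1 h2 (h3 _ hS).
  split; [exact: (step None)|exact: (step (Some false))|].
  move=> j jS; rewrite tp; case: eqP => [->|/eqP ne]; first exact: (step (Some true)).
  by apply: (hE t (run_head x w t)) => //; [rewrite eq_sym|apply: h3].
exists w; first by rewrite sw.
exists P; split=> //; rewrite -/(run x w P) run_accepting.
have [h1 h2 h3] := hrun P (leqnn P).
have hS : run_head x w P <= S by have := run_head_le x w P; rewrite /S; lia.
have := ha (inr (inord (run_head x w P), run_state x w P, run_tape x w P (run_head x w P))).
rewrite /satisfies /=; case: ifP => // _ /=.
by rewrite inordK // h1 h2 (h3 _ hS).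
Qed.

Definition run_assignment x w (v : var) : bool :=
  match v with
  | inl (inl (inl i)) => nth false x i
  | inl (inl (inr (t, j))) => run_head x w t == j
  | inl (inr (t, q)) => run_state x w t == q
  | inr (t, j, a) => run_tape x w t j == a
  end.

Lemma accepts_satisfiable x w : size x = m -> size w <= W ->
  accepts_within Mc (tape_word x w) P -> forall c, satisfies (run_assignment x w) x c.
Proof.
move=> hx hw [k [kP acc]].
have accP : tm_accepting (run x w P) by rewrite (run_halt (k := k)).
pose al := run_assignment x w.
have ahead t j : t <= P -> j <= S -> al (vhead t j) = (run_head x w t == j).
  by move=> tP jS; rewrite /al /= !inordK.
have astate t q : t <= P -> al (vstate t q) = (run_state x w t == q).
  by move=> tP; rewrite /al /= !inordK.
have acell t j a : t <= P -> j <= S -> al (vcell t j a) = (run_tape x w t j == a).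
  by move=> tP jS; rewrite /al /= !inordK.
rewrite -/al.
have acell0 j a : j <= S -> al (vcell 0 j (inord a)) = (inord (nth 0 (tape_word x w) j) == inord a :> 'I_G.+4).
  by move=> jS; rewrite acell.
have ainput i : al (vinput i) = nth false x i by [].
clearbody al.
case=> [[[[[i|[j b]]|b]|[[[[t h] q] a] kk]]|[[[t h] j] a]]|[[h q] a]].
- by rewrite /satisfies /= ainput eqxx.
- have jS : j <= S by rewrite -ltnS.
  rewrite /satisfies /=; case: insubP => [i _ ei|hj].
    rewrite /= ainput acell0 // nth_tape_word // -ei ltn_ord.
    by case: nth; case: b; rewrite /= ?eqxx ?orbT.
  rewrite /= in hj; case: eqP => [ej|nj]; first by rewrite /= acell0 // nth_tape_word // ej ltnn !eqxx.
  have hn j' : m < j' -> j' <= S -> nth 0 (tape_word x w) j' =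
      if j' - m.+1 < size w then (if nth false w (j' - m.+1) then 2 else 1) else 0.
    move=> h1 h2; rewrite nth_tape_word // ifF; last by lia.
    by rewrite ifF //; lia.
  have mj : m < j by lia.
  case: leqP => hjW; last first.
    rewrite /= acell0 // hn // ifF ?eqxx //; lia.
  case: b; rewrite /= !acell0 // ?hn //; try lia.
    by case: ltnP => _; [case: nth|]; rewrite /= ?eqxx ?orbT.
  case: ltnP => h1; last first.
    have e : (j.+1 - m.+1 < size w) = false by lia.
    by rewrite e !eqxx.
  have e : (inord (if nth false w (j - m.+1) then 2 else 1) == inord 0 :> 'I_G.+4) = false.
    by apply/eqP => /(congr1 val); case: nth; rewrite /= !inordK.
  by rewrite e.
- by rewrite /satisfies /=; case: b; rewrite ?ahead ?astate.
- rewrite /satisfies /=.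
  have tP : t <= P by apply: ltnW.
  have hS : h <= S by rewrite -ltnS.
  case E: next_local => [[q' a'] h']; rewrite /= !ahead ?astate ?acell // !eqbF_neg ?eqb_id.
  case: eqP => //= e1; case: eqP => //= e2; case: eqP => //= e3.
  have [s1 s2 s3] := run_step x w t; rewrite e1 e2 e3 E /= in s1 s2 s3.
  have hh : h' <= S by rewrite -s2; have := run_head_le x w t.+1; have := ltn_ord t; rewrite /S; lia.
  case: kk => [[]|]; rewrite ?ahead ?astate ?acell ?ltn_ord // ?s1 ?s2 ?s3 ?eqxx //.
- rewrite /satisfies /=.
  have tP : t <= P by apply: ltnW.
  have hS : h <= S by rewrite -ltnS.
  have jS : j <= S by rewrite -ltnS.
  case: eqP => [_|/eqP ne]; first by rewrite /=; case: (al _).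
  rewrite /= !ahead ?acell // !eqbF_neg ?eqb_id.
  case: eqP => //= e1; case: eqP => //= e3.
  have ne' : (val j == val h) = false by rewrite eq_sym; apply: negPf ne.
  by have [_ _ ->] := run_step x w t; rewrite e1 ne' e3 eqxx.
rewrite /satisfies; have hS : h <= S by rewrite -ltnS.
rewrite /=; case: ifP => [_|na]; first by rewrite /=; case: (al _).
rewrite /= !ahead ?astate ?acell // !eqbF_neg ?eqb_id.
case: eqP => //= e1; case: eqP => //= e2; case: eqP => //= e3.
by move: accP; rewrite run_accepting e1 e2 e3 na.
Qed.

End CookLevin.

(** * Hamiltonicity of projected graphs *)

Lemma poly_bounded_succ (f : nat -> nat) : poly_bounded f -> poly_bounded (fun m => (f m).+1).
Proof.
move=> hf; apply: (poly_bounded_le (g := fun m => f m + 1)); first by move=> m; rewrite addn1.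
exact: poly_bounded_add hf (poly_bounded_const 1).
Qed.

Ltac poly_bounded_tac := repeat first
  [ assumption | exact: poly_bounded_const | exact: poly_bounded_id
  | apply: poly_bounded_succ | apply: poly_bounded_add | apply: poly_bounded_mul
  | apply: poly_bounded_exp ].

Lemma poly_bounded_threshold_size (M r n : nat -> nat) :
  poly_bounded M -> poly_bounded r -> poly_bounded n ->
  poly_bounded (fun m => threshold_size (M m) (r m) (n m)).
Proof.
move=> hM hr hn.
have h1 : poly_bounded (fun m => pc_zeta (M m) (r m)) by rewrite /pc_zeta; poly_bounded_tac.
have h2 : poly_bounded (fun m => pc_err (M m) (r m)) by rewrite /pc_err; poly_bounded_tac.
have h3 : poly_bounded (fun m => pc_scale (M m) (r m) (n m)).
  by rewrite /pc_scale; poly_bounded_tac.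
have h4 : poly_bounded (fun m => pc_steps (M m) (r m) (n m)).
  by rewrite /pc_steps; poly_bounded_tac.
have h5 : poly_bounded (fun m => pc_bound (M m) (r m) (n m)).
  by rewrite /pc_bound; poly_bounded_tac.
have h6 : poly_bounded (fun m => pc_range (M m) (r m) (n m)).
  by rewrite /pc_range; poly_bounded_tac.
have h7 : poly_bounded (fun m => pc_width (M m) (r m) (n m)).
  by rewrite /pc_width; poly_bounded_tac.
have h8 : poly_bounded (fun m => op_cost (pc_width (M m) (r m) (n m))).
  by rewrite /op_cost; poly_bounded_tac.
have h9 : poly_bounded (fun m => step_cost (r m) (n m) (op_cost (pc_width (M m) (r m) (n m)))).
  by rewrite /step_cost; poly_bounded_tac.
by rewrite /threshold_size; poly_bounded_tac.
Qed.

Section Projection.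
Variables (Mc : TM) (m P W : nat).

Definition node : finType := sat_node (var Mc m P W) (clause Mc m P W).
Definition node_arc (x : seq bool) : rel node := sat_arc (@lit Mc m P W x).
Definition vertex : finType := (node * option bool)%type.
Definition vertex_edge (x : seq bool) : rel vertex := undirected (node_arc x).

Definition arc_input (v w : node) : nat :=
  match v, w with inr c, _ | _, inr c => input_of c | _, _ => 0 end.

Lemma node_arc_input x v w : node_arc x v w = node_arc (nseq m (nth false x (arc_input v w))) v w.
Proof.
by case: v w => [[i k]|c] [[i' k']|c'] //=; rewrite /lit literals_input.
Qed.

(** Only edges between an out-vertex and an in-vertex depend on the input, through the arc that
    starts at the out-vertex; for other pairs the value is arbitrary. *)
Definition edge_input (a b : vertex) : nat :=
  if a.2 is Some true then arc_input a.1 b.1 else arc_input b.1 a.1.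

Lemma vertex_edge_input x a b :
  vertex_edge x a b = vertex_edge (nseq m (nth false x (edge_input a b))) a b.
Proof.
by case: a b => [v [[]|]] [w [[]|]]; rewrite /vertex_edge /undirected /half_edge //= node_arc_input.
Qed.

Lemma card_node_gt2 : 2 < #|node|.
Proof.
rewrite card_sum card_prod card_ord; set N := #|clause _ _ _ _|.
have : 0 < #|var Mc m P W| by apply/card_gt0P; exists (@vstate Mc m P W 0 ord0).
by case: #|_| => // k _; rewrite mulSn; lia.
Qed.

Lemma card_vertex : #|vertex| = #|node| * 3.
Proof. by rewrite card_prod card_option card_bool. Qed.

Lemma accepts_ham_cycle x : size x = m ->
  (exists w, size w <= W /\ accepts_within Mc (enc_bits x ++ 3 :: enc_bits w) P) <->
  exists p, ham_cycle (vertex_edge x) p.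
Proof.
move=> hx; split=> [[w [hw acc]]|[p hp]].
  have hsat c : exists i, lit x c i (@run_assignment Mc m P W x w i).
    by apply/satisfiesP; apply: accepts_satisfiable acc c.
  have [ch hch] := fin_all_exists hsat.
  have [p hp] := sat_ham_cycle hch (@vstate Mc m P W 0 ord0).
  apply: (undirected_ham_cycle _ hp); apply/eqP => p0.
  by have := card_node_gt2; rewrite /node -(ham_cycle_size hp) p0.
have [s [s1 s2 s3]] := ham_cycle_successor hp card_node_gt2.
have [alpha ha] := successor_sat s1 s2 s3.
have [c|w hw acc] := @satisfiable_accepts Mc m P W x alpha hx; first exact/satisfiesP.
by exists w.
Qed.

End Projection.

(** * Polynomial bounds and the final circuit family *)

Lemma poly_bounded_card_vertex Mc (p q : nat -> nat) : poly_bounded p -> poly_bounded q ->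
  poly_bounded (fun m => #|vertex Mc m (p m) (q m)|).
Proof.
move=> hp hq.
have hv : poly_bounded (fun m => #|var Mc m (p m) (q m)|).
  apply: (poly_bounded_le (g := fun m => m + (p m).+1 * (p m + m + q m + 2).+1
     + (p m).+1 * (tm_Q Mc).+1 + (p m).+1 * (p m + m + q m + 2).+1 * (tm_G Mc).+4)).
    by move=> m; rewrite !card_sum !card_prod !card_ord.
  by poly_bounded_tac.
have hc : poly_bounded (fun m => #|clause Mc m (p m) (q m)|).
  apply: (poly_bounded_le (g := fun m => m + (p m + m + q m + 2).+1 * 2 + 2
     + p m * (p m + m + q m + 2).+1 * (tm_Q Mc).+1 * (tm_G Mc).+4 * 3
     + p m * (p m + m + q m + 2).+1 * (p m + m + q m + 2).+1 * (tm_G Mc).+4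
     + (p m + m + q m + 2).+1 * (tm_Q Mc).+1 * (tm_G Mc).+4)).
    by move=> m; rewrite !card_sum !card_prod !card_ord card_option !card_bool.
  by poly_bounded_tac.
apply: (poly_bounded_le (g := fun m => (#|var Mc m (p m) (q m)| *
    (3 * #|clause Mc m (p m) (q m)| + 2).+1 + #|clause Mc m (p m) (q m)|) * 3)).
  by move=> m; rewrite card_vertex card_sum card_prod card_ord.
by poly_bounded_tac.
Qed.

Lemma TSP_slice_nonempty n : 3 <= n -> exists s, TSP s /\ size s = size (edges n).
Proof.
move=> hn; exists [seq cycle_edge n (iota 0 n) e.1 e.2 | e <- edges n].
by split; [exists n, (iota 0 n)|rewrite size_map].
Qed.

Theorem theorem9 : ~ NP_subset_Ppoly -> ~ CF TSP.
Proof.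
move=> hNP [pc [/poly_fun_bounded hpc hCF]]; apply: hNP => L [Mc [p [q [hp [hq hL]]]]].
pose n m := #|vertex Mc m (p m) (q m)|.
pose M m := size (edges (n m)).
pose r m := pc (M m) + 1.
have hM : poly_bounded M.
  have hn : poly_bounded n by apply: poly_bounded_card_vertex; apply: poly_fun_bounded.
  apply: (poly_bounded_le (g := fun m => n m * n m)); last exact: poly_bounded_mul.
  move=> m; have := double_size_edges (n m); rewrite -/(M m).
  have : n m * (n m).-1 <= n m * n m by rewrite leq_mul2l leq_pred orbT.
  lia.
have hr : poly_bounded r.
  by apply: poly_bounded_add (poly_bounded_const 1); apply: poly_bounded_comp hpc hM.
have [pp hpp ppge] := poly_bounded_fun (poly_bounded_threshold_size hM hr
   (poly_bounded_succ (poly_bounded_add hr (poly_bounded_add (poly_bounded_const 1) hM)))).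
exists pp; split=> // m.
have n3 : 3 <= n m.
  by rewrite /n card_vertex; have := card_node_gt2 Mc m (p m) (q m); case: #|_| => // k; lia.
have [v0 _] : exists v : vertex Mc m (p m) (q m), v \in predT.
  by apply/card_gt0P; apply: leq_trans n3.
pose ed k := nth (0, 0) (edges (n m)) k.
pose ev i := nth v0 (enum (vertex Mc m (p m) (q m))) i.
pose idx k := edge_input (ev (ed k).1) (ev (ed k).2).
(* By [vertex_edge_input] the constant word of the one relevant bit decides whether edge [k] is
   present. *)
pose phi k b := ~~ vertex_edge (nseq m b) (ev (ed k).1) (ev (ed k).2).
have [A [B [b hAB]]] := hCF (M m).
have [C sC hC] := cover_circuit m idx phi hAB (TSP_slice_nonempty n3).
exists C; split; first exact: leq_trans sC (ppge m).
move=> x hx; rewrite hL hx hC //.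
rewrite (@accepts_ham_cycle Mc m (p m) (q m) x hx).
have ham := @TSP_ham_cycle _ (vertex_edge x) v0 (@undirected_sym _ _) n3.
have E k : missing (vertex_edge x) v0 k = phi k (nth false x (idx k)).
  by rewrite /missing vertex_edge_input.
split=> [hp'|[s [h1 h2 h3]]].
  have [s [h1 h2 h3]] := proj2 ham hp'.
  by exists s; split=> // e he hs; have := h3 e he hs; rewrite E.
by apply: (proj1 ham); exists s; split=> // e he hs; rewrite E; apply: h3.
Qed.
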